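(* (i) Let $\varphi\in\Phi$ with doubling exponent $s$, and let $\mu$ be a finite positive Borel measure on $\mathbb R^d$ (not necessarily satisfying $\mu(B(x,r))\le\varphi(r)$). Then for every measurable set $Q$ in $\mathbb R^d$, $$\int_Q|\mathfrak R_{\mu,\varepsilon}^\varphi\chi_Q(x)|^2\,d\mu(x)\le C\int_QW_\varphi^{\mu|Q}(x)\,d\mu(x),\qquad\varepsilon>0,$$ where $C$ depends only on $s$. (ii) Moreover, if $\mu(B(x,t))\to0$ as $t\to0$ for every $x\in\mathbb R^d$, and if $\varphi\in\Phi$, $\varphi$ is concave, and the doubling exponent satisfies $s\in(0,1)$, then $$\liminf_{\varepsilon\to0}\int_{\mathbb R^d}|\mathfrak R_{\mu,\varepsilon}^\varphi\mathbf 1(x)|^2\,d\mu(x)\ge c\int_{\mathbb R^d}W_\varphi^\mu(x)\,d\mu(x),$$ where $c=c(s)>0$ depends only on $s$. Both sides of the last inequality might be infinite.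
   Context: Let $d\ge1$ and $B(x,r)=\{y\in\mathbb R^d:|y-x|<r\}$. $\mu|Q$ denotes the restriction of $\mu$ to $Q$, and $\mathbf 1$ is the constant function $1$. The class $\Phi$ consists of the functions $\varphi(t)$, $t\ge0$, such that: (I) $\varphi(0)=0$, and $\varphi$ is increasing and differentiable for $t>0$; (II) $\varphi(t)\to\infty$ as $t\to\infty$; (III) $\varphi'(t)$, $t>0$, is monotonic (so $\varphi$ is either convex or concave); (IV) $\varphi(2t)\le2^s\varphi(t)$ for all $t\ge0$ and for some $s>0$ depending on $\varphi$ (the doubling exponent). The $\varepsilon$-truncated $\varphi$-operator is $$\mathfrak R_{\mu,\varepsilon}^\varphi f(x)=\int_{|y-x|>\varepsilon}\frac{y-x}{|y-x|}\cdot\frac1{\varphi(|y-x|)}\,f(y)\,d\mu(y),\quad f\in L^2(\mu),\ \varepsilon>0.$$ The $\varphi$-Wolff potential of a Borel measure $\mu$ is $$W_\varphi^\mu(x)=\int_0^\infty\left(\frac{\mu(B(x,t))}{\varphi(t)}\right)^2\frac{d\varphi(t)}{\varphi(t)}.$$ *)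

(* Defs.v *)
From HB Require Import structures.
From mathcomp Require Import all_boot all_order all_algebra.
From mathcomp Require Import all_classical all_reals all_analysis.

Set Implicit Arguments.
Unset Strict Implicit.
Unset Printing Implicit Defensive.

Import Order.TTheory GRing.Theory Num.Theory.
Import numFieldNormedType.Exports.

Local Open Scope classical_set_scope.
Local Open Scope ring_scope.

(* R^d with its Borel sigma-algebra. The library's topology on row vectors is
   the product topology, so [open] is the usual Euclidean notion. *)
Notation borel_rV R d := (g_sigma_algebraType (@open 'rV[R]_d)).

(* The library's norm on 'rV[R]_d is the sup norm, hence a separate
   Euclidean norm. *)
Definition enorm (R : realType) (d : nat) (v : 'rV[R]_d) : R :=
  Num.sqrt (\sum_(i < d) v ord0 i ^+ 2).

Definition eball (R : realType) (d : nat) (x : 'rV[R]_d) (r : R) :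
    set (borel_rV R d) :=
  [set y : 'rV[R]_d | enorm (y - x) < r].

(* A function on [0, +oo[ is represented by a total phi : R -> R of which only
   the values at t >= 0 are used. *)
Definition doubling_exponent (R : realType) (phi : R -> R) (s : R) : Prop :=
  0 < s /\ forall t : R, 0 <= t -> phi (2 * t) <= 2 `^ s * phi t.

Record class_Phi (R : realType) (phi : R -> R) : Prop := ClassPhi {
  class_Phi0 : phi 0 = 0 ;
  class_Phi_incr :
    {in Num.nneg &, {homo phi : t u / t < u}} ;
  class_Phi_derivable : forall t : R, 0 < t -> derivable phi t 1 ;
  class_Phi_pinfty : phi t @[t --> +oo] --> +oo ;
  class_Phi_monotonic :
    {in Num.pos &, {homo derive1 phi : t u / t <= u}} \/
    {in Num.pos &, {homo derive1 phi : t u /~ t <= u}} ;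
  class_Phi_doubling : exists s : R, doubling_exponent phi s
}.

Definition concave_phi (R : realType) (phi : R -> R) : Prop :=
  @convex_function R R^o `[0, +oo[%classic (fun t => - phi t).

(* The vector-valued integral is taken coordinatewise. *)
Definition phi_operator (R : realType) (d : nat) (phi : R -> R)
    (mu : {measure set (borel_rV R d) -> \bar R}) (eps : R)
    (f : borel_rV R d -> R) (x : 'rV[R]_d) : 'rV[R]_d :=
  \row_(i < d)
    (\int[mu]_(y in [set y : 'rV[R]_d | (eps < enorm (y - x))%R])
       ((((y : 'rV[R]_d) - x) ord0 i / enorm ((y : 'rV[R]_d) - x))
        * (phi (enorm ((y : 'rV[R]_d) - x)))^-1 * f y)).

(* Since phi is differentiable on ]0, +oo[ with monotonic (hence continuous)
   derivative, dphi(t) is phi'(t) dt there. *)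
Definition phi_wolff (R : realType) (d : nat) (phi : R -> R)
    (mu : {measure set (borel_rV R d) -> \bar R}) (x : 'rV[R]_d) : \bar R :=
  (\int[lebesgue_measure]_(t in `]0%R, +oo[)
     ((mu (eball x t) * ((phi t)^-1)%:E) ^+ 2
      * (derive1 phi t / phi t)%:E))%E.

(* Main.v *)
Require Import Defs.
From HB Require Import structures.
From mathcomp Require Import all_boot all_order all_algebra.
From mathcomp Require Import all_classical all_reals all_analysis.
From mathcomp Require Import measurable_realfun.
From mathcomp Require Import ring lra.

(* Write [L = 2 ^ s].  By the law of cosines, [\int |R_eps 1|^2] is the triple
   integral of a kernel depending on the sides of the triangle [x, y, z] only.
   Averaging over the three rotations of [(x, y, z)] replaces it by one third of
   a symmetric kernel [P], in the manner of Melnikov's symmetrization for the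
   Menger curvature.  The energy [\int W] is likewise the triple integral of
   [phi(max(|x - y|, |x - z|))^-2 / 2].  Let [a <= b <= c] be the sides.

   Upper bound: [P <= C (phi(c)^-2 + a / (c phi(a) phi(c)))].  The last term is
   not controlled pointwise when [s > 1], but it is at most a constant times
   [2^-i L^-i min(phi(a)^-2, L^(2i) phi(c)^-2)] for some [i]; after integration,
   the layer cake formula and the AM-GM inequality gain back a factor [L^i],
   and the sum over [i] converges.

   Lower bound: concavity gives [phi(c) - phi(b) <= phi(2a) - phi(a) <=
   (L - 1) phi(a)], so that [P >= (1 - L/2) phi(c)^-2] as [L < 2]; moreover [P]
   stays nonnegative when a side is shorter than [eps]. *)

Set Implicit Arguments.
Unset Strict Implicit.
Unset Printing Implicit Defensive.

Import Order.TTheory GRing.Theory Num.Theory.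
Import numFieldNormedType.Exports.

Local Open Scope classical_set_scope.
Local Open Scope ring_scope.

(** * Growth of functions of class Phi *)

(** No pointwise upper bound can hold: for [phi(t) = t^s] with [s > 1], the term
    [a / (c phi(a) phi(c))] exceeds [phi(c)^-2] by the factor [(c / a)^(s - 1)]. What helps is that
    [a] and [c] leave a common vertex [x]. For fixed [x], the double integral over [(y, z)] of
    [min(f(y), k^2 f(z))] is at most [k] times that of [min(f(y), f(z))], and not [k^2] times,
    because the two variables separate on each level set. With [k = L^i] this growth is cancelled by
    the weight [L^-i], and the decay [2^-i], which comes from [a / c], is left for the summation.
    All estimates are made at a fixed truncation [eps], with constants in [L] alone. There the
    kernels are bounded and the measure is finite, so the identity between the operator and the
    triple integral is one between finite quantities, even if the Wolff energy is infinite. The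
    integral estimates are stated for an abstract distance [D], which keeps the dimension out of the
    constants; the law of cosines links them to the operator. *)

Section phi.
Context {R : realType} (phi : R -> R).
Hypothesis Hphi : class_Phi phi.

Lemma phi_lt t u : 0 <= t -> t < u -> phi t < phi u.
Proof.
move=> t0 tu; apply: (class_Phi_incr Hphi) => //; rewrite nnegrE//.
exact: le_trans t0 (ltW tu).
Qed.

Lemma phi_le t u : 0 <= t -> t <= u -> phi t <= phi u.
Proof. by move=> t0; rewrite le_eqVlt => /predU1P[->//|/(phi_lt t0)/ltW]. Qed.

Lemma phi_gt0 t : 0 < t -> 0 < phi t.
Proof. by rewrite -{2}(class_Phi0 Hphi); exact: phi_lt. Qed.

Lemma phi_continuous t : 0 < t -> {for t, continuous phi}.
Proof.
by move=> t0; apply/differentiable_continuous/derivable1_diffP/(class_Phi_derivable Hphi).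
Qed.

Lemma phi_MVT b c : 0 < b -> b < c ->
  exists2 x, b < x < c & phi c - phi b = derive1 phi x * (c - b).
Proof.
move=> b0 bc; have [x xbc e] : exists2 x, x \in `]b, c[ & phi c - phi b = derive1 phi x * (c - b).
  apply: MVT bc _ _ => [x|].
    rewrite in_itv/= => /andP[bx _]; rewrite derive1E.
    by apply/derivableP/(class_Phi_derivable Hphi)/(lt_trans b0).
  apply: continuous_in_subspaceT => x; rewrite inE/= in_itv/= => /andP[bx _].
  exact/phi_continuous/(lt_le_trans b0).
by exists x => //; move: xbc; rewrite in_itv.
Qed.

Variable L : R.
Hypothesis L1 : 1 < L.
Hypothesis dbl : forall t, 0 <= t -> phi (2 * t) <= L * phi t.

Lemma phi_iter_dbl n t : 0 <= t -> phi (2 ^+ n * t) <= L ^+ n * phi t.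
Proof.
move=> t0; elim: n => [|n IH]; first by rewrite !expr0 !mul1r.
rewrite !exprS -!mulrA (le_trans (dbl _))//.
  by rewrite mulr_ge0// exprn_ge0.
by rewrite ler_pM2l// (lt_trans _ L1).
Qed.

Lemma phi_le_dbl b c : 0 <= b -> 0 <= c -> c <= 2 * b -> phi c <= L * phi b.
Proof. by move=> b0 c0 cb; apply: le_trans (dbl b0); exact: phi_le. Qed.

(** The slope is [phi'(x)] for some [x] between [b] and [c], and a monotonic [phi'] is bounded there
    by a mean slope on one side. If [phi'] increases, the mean over [[c, 2c]] is at most
    [(L - 1) phi(c) / c]; if it decreases, the mean over [[b/2, b]] is at most
    [2 phi(b) / b <= 4 phi(c) / c]. The constant [4 + L] covers both. *)
Lemma phi_increment_le b c : 0 < b -> b <= c -> c <= 2 * b ->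
  phi c - phi b <= (4 + L) * (phi c / c) * (c - b).
Proof.
move=> b0; rewrite le_eqVlt => /predU1P[->|bc] c2b; first by rewrite !subrr mulr0.
have c0 : 0 < c := lt_trans b0 bc.
have [x /andP[bx xc] ->] := phi_MVT b0 bc.
rewrite ler_pM2r ?subr_gt0//.
have pc0 := phi_gt0 c0; have pb0 := phi_gt0 b0.
have [mono|mono] := class_Phi_monotonic Hphi.
- have c2 : c < 2 * c by lra.
  have [y /andP[cy y2c] e] := phi_MVT c0 c2.
  have xy : derive1 phi x <= derive1 phi y by apply: mono; rewrite ?posrE; lra.
  apply: (le_trans xy).
  have -> : derive1 phi y = (phi (2 * c) - phi c) / c.
    by rewrite e; field; rewrite gt_eqF.
  rewrite mulrA ler_pM2r ?invr_gt0//.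
  have := dbl (ltW c0); lra.
- have b20 : 0 < b / 2 by lra.
  have b2b : b / 2 < b by lra.
  have [y /andP[cy y2c] e] := phi_MVT b20 b2b.
  have xy : derive1 phi x <= derive1 phi y by apply: mono; rewrite ?posrE; lra.
  apply: (le_trans xy).
  have -> : derive1 phi y = (phi b - phi (b / 2)) / (b / 2).
    by rewrite e; field; rewrite gt_eqF.
  rewrite ler_pdivrMr//.
  have pb20 := phi_gt0 b20; have pbc : phi b <= phi c by apply: phi_le; lra.
  have L0 : 0 < L := lt_trans ltr01 L1.
  have L4 : 0 < 4 + L by lra.
  have Lpc : 0 < L * phi c by rewrite mulr_gt0.
  have -> : (4 + L) * (phi c / c) * (b / 2) = (4 + L) * phi c * (b / 2 / c) by ring.
  apply: (@le_trans _ _ ((4 + L) * phi c * (1 / 4))); first by lra.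
  rewrite ler_pM2l ?mulr_gt0//.
  by rewrite ler_pdivlMr//; lra.
Qed.

End phi.

(** * The symmetrized kernel of a triangle *)

Section triangle_kernel.
Context {R : realType} (phi : R -> R).

(* The cosine of the angle between the sides [b] and [c] is expressed through
   the opposite side [a] by the law of cosines. *)
Definition angle_kernel (eps a b c : R) : R :=
  if (eps < b) && (eps < c) then
    (b ^+ 2 + c ^+ 2 - a ^+ 2) / (2 * b * c * phi b * phi c) else 0.

(** For [phi(t) = t] and sides longer than [eps] this is half the squared Menger curvature,
    [1 / (2 r^2)] with [r] the circumradius. *)
Definition sym_kernel eps a b c :=
  angle_kernel eps a b c + angle_kernel eps b c a + angle_kernel eps c a b.

Lemma angle_kernelC eps a b c : angle_kernel eps a b c = angle_kernel eps a c b.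
Proof.
rewrite /angle_kernel andbC; case: ifP => // _.
by congr (_ / _); ring.
Qed.

Lemma sym_kernel_swap12 eps a b c : sym_kernel eps a b c = sym_kernel eps b a c.
Proof.
rewrite /sym_kernel (angle_kernelC _ a) (angle_kernelC _ b) (angle_kernelC _ c).
by ring.
Qed.

Lemma sym_kernel_swap23 eps a b c : sym_kernel eps a b c = sym_kernel eps a c b.
Proof.
rewrite /sym_kernel (angle_kernelC _ a) (angle_kernelC _ b) (angle_kernelC _ c).
by ring.
Qed.

Lemma triangle_wlog (P : R -> R -> R -> Prop) :
  (forall a b c, P a b c -> P b a c) -> (forall a b c, P a b c -> P a c b) ->
  (forall a b c, a <= b -> b <= c -> P a b c) -> forall a b c, P a b c.
Proof.
move=> s12 s23 H a b c.
have [ab|/ltW ba] := leP a b; have [bc|/ltW cb] := leP b c; have [ac|/ltW ca] := leP a c.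
- exact: H.
- exact: H.
- exact/s23/H.
- exact/s23/s12/H.
- exact/s12/H.
- exact/s12/s23/H.
- exact/s12/s23/s12/H.
- exact/s12/s23/s12/H.
Qed.

Hypothesis Hphi : class_Phi phi.
Variable eps : R.
Hypothesis eps0 : 0 < eps.

Lemma inv_phi_le t u : 0 < t -> t <= u -> (phi u)^-1 <= (phi t)^-1.
Proof.
move=> t0 tu; rewrite lef_pV2 ?posrE ?(phi_gt0 Hphi)//; last exact: lt_le_trans tu.
by rewrite (phi_le Hphi)// ltW.
Qed.

Lemma inv_phi_gt0 t : 0 < t -> 0 < (phi t)^-1.
Proof. by move=> t0; rewrite invr_gt0 (phi_gt0 Hphi). Qed.

(** A cosine is at most 1; in terms of the sides, [(b - c)^2 <= a^2]. *)
Lemma angle_kernel_le a b c : 0 <= a -> c - b <= a -> b - c <= a ->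
  eps < b -> eps < c -> angle_kernel eps a b c <= (phi b)^-1 * (phi c)^-1.
Proof.
move=> a0 cb bc eb ec; rewrite /angle_kernel eb ec/=.
have b0 := lt_trans eps0 eb; have c0 := lt_trans eps0 ec.
have pb0 := phi_gt0 Hphi b0; have pc0 := phi_gt0 Hphi c0.
rewrite ler_pdivrMr ?mulr_gt0//.
have -> : (phi b)^-1 * (phi c)^-1 * (2 * b * c * phi b * phi c) = 2 * b * c.
  by field; rewrite !gt_eqF.
nra.
Qed.

Lemma angle_kernel_ge a b c : 0 <= a -> b <= a + c -> c <= a + b -> a <= b + c ->
  eps < b -> eps < c -> - ((phi b)^-1 * (phi c)^-1) <= angle_kernel eps a b c.
Proof.
move=> a0 cb bc abc eb ec; rewrite /angle_kernel eb ec/=.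
have b0 := lt_trans eps0 eb; have c0 := lt_trans eps0 ec.
have pb0 := phi_gt0 Hphi b0; have pc0 := phi_gt0 Hphi c0.
rewrite ler_pdivlMr ?mulr_gt0//.
have -> : - ((phi b)^-1 * (phi c)^-1) * (2 * b * c * phi b * phi c) = - (2 * b * c).
  by field; rewrite !gt_eqF.
nra.
Qed.

Lemma angle_kernel_bound a b c : 0 <= a -> b <= a + c -> c <= a + b -> a <= b + c ->
  `|angle_kernel eps a b c| <= (phi eps)^-1 ^+ 2.
Proof.
move=> a0 bac cab abc.
have [/andP[eb ec]|ebc] := boolP ((eps < b) && (eps < c)); last first.
  by rewrite /angle_kernel (negbTE ebc) normr0 exprn_ge0// invr_ge0 ltW// phi_gt0.
have b0 := lt_trans eps0 eb; have c0 := lt_trans eps0 ec.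
apply: (@le_trans _ _ ((phi b)^-1 * (phi c)^-1)).
  by rewrite ler_norml angle_kernel_ge//= angle_kernel_le//; lra.
have h t : eps < t -> 0 <= (phi t)^-1 <= (phi eps)^-1.
  move=> et; have t0 := lt_trans eps0 et.
  by rewrite (ltW (inv_phi_gt0 t0)) inv_phi_le// ltW.
have /andP[? ?] := h b eb; have /andP[? ?] := h c ec.
by rewrite expr2 ler_pM.
Qed.

Variable L : R.
Hypothesis L1 : 1 < L.
Hypothesis dbl : forall t, 0 <= t -> phi (2 * t) <= L * phi t.

Definition trunc_inv t : R := if eps < t then (phi t)^-1 else 0.

(* With [L = 2 ^ s], the scale [i] is the one at which [phi v / phi u] is about
   [L ^ i]; there [u / v] is at most of order [2 ^- i]. *)
Definition hardy_term i u v : R :=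
  2^-1 ^+ i * (L^-1 ^+ i * Num.min (trunc_inv u ^+ 2) ((L ^+ i) ^+ 2 * trunc_inv v ^+ 2)).

Lemma hardy_term_ge0 i u v : 0 <= hardy_term i u v.
Proof.
have L0 := lt_trans ltr01 L1.
apply: mulr_ge0; first by rewrite exprn_ge0.
apply: mulr_ge0; first by rewrite exprn_ge0// invr_ge0 ltW.
by rewrite le_min sqr_ge0/= mulr_ge0 ?sqr_ge0.
Qed.

(** Hence the harmless term [phi(c)^-2] of the upper bound belongs to the same family as the
    critical one, with index 0. *)
Lemma hardy_term0 u v : eps < u -> u <= v -> hardy_term 0 u v = (phi v)^-1 ^+ 2.
Proof.
move=> eu uv; rewrite /hardy_term /trunc_inv eu (lt_le_trans eu uv) !expr0 expr1n !mul1r.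
have u0 := lt_trans eps0 eu; have v0 := lt_le_trans u0 uv.
have [pu pv] := (inv_phi_gt0 u0, inv_phi_gt0 v0).
by apply/min_idPr; rewrite ler_sqr ?nnegrE ?(ltW pu) ?(ltW pv)// inv_phi_le.
Qed.

(* The index is the least [i] with [phi c <= L ^+ i * phi a]. *)
Lemma hardy_term_exists a c : eps < a -> a <= c ->
  exists i, a / (c * phi a * phi c) <= 2 * L * hardy_term i a c.
Proof.
move=> ea ac; have a0 := lt_trans eps0 ea; have c0 := lt_le_trans a0 ac.
have pa0 := phi_gt0 Hphi a0; have pc0 := phi_gt0 Hphi c0.
have hL := L1; have L0 := lt_trans ltr01 L1.
have ex : exists i, phi c <= L ^+ i * phi a.
  have [n cn] : exists n, c / a <= 2 ^+ n :> R.
    have := archi_boundP (ltW (divr_gt0 c0 a0)); set n := Num.bound _ => h.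
    exists n; apply: (le_trans (ltW h)).
    by rewrite -natrX ler_nat ltnW// ltn_expl.
  exists n; apply: le_trans (phi_iter_dbl L1 dbl n (ltW a0)).
  apply: (phi_le Hphi) => //; first exact: ltW.
  by rewrite -ler_pdivrMr.
have [i hi imin] := ex_minnP ex; exists i.
have Li0 : 0 < L ^+ i by rewrite exprn_gt0.
have -> : hardy_term i a c = 2^-1 ^+ i * (L^-1 ^+ i * (phi a)^-1 ^+ 2).
  congr (_ * (_ * _)); rewrite /trunc_inv ea (lt_le_trans ea ac) -exprMn.
  apply/min_idPl; rewrite ler_sqr ?nnegrE; last 2 first.
  - exact/ltW/inv_phi_gt0.
  - exact/ltW/mulr_gt0/inv_phi_gt0.
  by rewrite ler_pdivlMr// mulrC ler_pdivrMr.
(* Minimality of [i = j + 1]: if [c <= 2^j a], doubling would give [phi c <= L^j phi a]. The factor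
   2 pays for the passage from [j] to [i]. *)
have aci : a / c <= 2 * 2^-1 ^+ i.
  case: i hi imin {Li0} => [|i] hi imin.
    by rewrite expr0 mulr1 ler_pdivrMr//; lra.
  rewrite exprS mulrA divff// mul1r exprVn ler_pdivrMr// ler_pdivlMl ?exprn_gt0//.
  rewrite leNgt; apply/negP => hc.
  have : phi c <= L ^+ i * phi a.
    apply: le_trans (phi_iter_dbl L1 dbl i (ltW a0)).
    by apply: (phi_le Hphi); rewrite ltW.
  by move=> /imin; rewrite ltnn.
(* Minimality again, read on the values of [phi]; here the passage from [j] to [i] costs [L]. *)
have pci : (phi c)^-1 <= L * (L^-1 ^+ i * (phi a)^-1).
  case: i hi imin {aci Li0} => [|i] hi imin.
    rewrite expr0 mul1r ler_pdivlMr// mulrC ler_pdivrMr//.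
    have : phi a <= phi c by apply: phi_le => //; exact: ltW.
    nra.
  rewrite exprS !mulrA divff ?gt_eqF// mul1r exprVn -invfM lef_pV2 ?posrE ?mulr_gt0 ?exprn_gt0//.
  rewrite leNgt; apply/negP => /ltW/imin; by rewrite ltnn.
have -> : a / (c * phi a * phi c) = a / c * (phi a)^-1 * (phi c)^-1.
  by rewrite -!mulrA -!invfM.
have -> : 2 * L * (2^-1 ^+ i * (L^-1 ^+ i * (phi a)^-1 ^+ 2)) =
    2 * 2^-1 ^+ i * (phi a)^-1 * (L * (L^-1 ^+ i * (phi a)^-1)).
  by rewrite expr2; ring.
have [ia ic] := (inv_phi_gt0 a0, inv_phi_gt0 c0).
apply: ler_pM => //; [|exact: ltW|].
  by rewrite mulr_ge0 ?(ltW ia)// divr_ge0 ?ltW.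
by rewrite ler_pM2r ?invr_gt0.
Qed.

(** The sum factors as [(b + c)(a^2 - (b - c)^2) / (2abc)]; it remains to drop [(b - c)^2] and to
    use [b + c <= 4b]. *)
Lemma cos_sum_le (a b c : R) : 0 < a -> 0 < b -> 0 < c -> c <= 2 * b ->
  (c ^+ 2 + a ^+ 2 - b ^+ 2) / (2 * c * a) + (a ^+ 2 + b ^+ 2 - c ^+ 2) / (2 * a * b)
  <= 2 * a / c.
Proof.
move=> a0 b0 c0 cb.
have -> : (c ^+ 2 + a ^+ 2 - b ^+ 2) / (2 * c * a) + (a ^+ 2 + b ^+ 2 - c ^+ 2) / (2 * a * b)
  = ((b + c) * (a ^+ 2 - (b - c) ^+ 2)) / (2 * a * b * c).
  by field; rewrite !gt_eqF.
rewrite ler_pdivrMr ?mulr_gt0//.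
have -> : 2 * a / c * (2 * a * b * c) = 4 * b * a ^+ 2.
  by field; rewrite gt_eqF.
have h : 0 <= (b + c) * (b - c) ^+ 2 by rewrite mulr_ge0 ?sqr_ge0// addr_ge0 ?ltW.
have h2 : 0 <= (4 * b - (b + c)) * a ^+ 2 by rewrite mulr_ge0 ?sqr_ge0//; lra.
nra.
Qed.

(* The cosines of the two angles at the shortest side [a] nearly cancel when
   [a] is much smaller than [c], whence the factor [a / c]. *)
Lemma sym_kernel_ordered_le a b c : eps < a -> a <= b -> b <= c -> c <= a + b ->
  sym_kernel eps a b c <= L * (phi c)^-1 ^+ 2 + (2 + (4 + L) * L) * (a / (c * phi a * phi c)).
Proof.
move=> ea ab bc cab; have a0 := lt_trans eps0 ea; have b0 := lt_le_trans a0 ab.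
have c0 := lt_le_trans b0 bc; have hL := L1; have L0 := lt_trans ltr01 L1.
have c2b : c <= 2 * b by lra.
have eb := lt_le_trans ea ab; have ec := lt_le_trans eb bc.
have [[pa pb] pc] := (inv_phi_gt0 a0, inv_phi_gt0 b0, inv_phi_gt0 c0).
have [[fa fb] fc] := (phi_gt0 Hphi a0, phi_gt0 Hphi b0, phi_gt0 Hphi c0).
have pbc : (phi b)^-1 <= L * (phi c)^-1.
  rewrite ler_pdivlMr// mulrC ler_pdivrMr//.
  by apply: (phi_le_dbl Hphi) => //; exact: ltW.
rewrite /sym_kernel -addrA; apply: lerD.
  have h := @angle_kernel_le a b c; apply: (le_trans (h _ _ _ eb ec)); [lra..|].
  by rewrite expr2 mulrA ler_pM2r.
rewrite /angle_kernel ea eb ec/=.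
set cosb := (c ^+ 2 + a ^+ 2 - b ^+ 2) / (2 * c * a).
set cosc := (a ^+ 2 + b ^+ 2 - c ^+ 2) / (2 * a * b).
(* An Abel summation that isolates two small quantities of order [a / c]: the sum of the two
   cosines, and the increment of [1 / phi] from [b] to [c], where [c - b <= a]. *)
have -> : (c ^+ 2 + a ^+ 2 - b ^+ 2) / (2 * c * a * phi c * phi a) +
   (a ^+ 2 + b ^+ 2 - c ^+ 2) / (2 * a * b * phi a * phi b) =
   (phi a)^-1 * ((cosb + cosc) * (phi c)^-1 + cosc * ((phi b)^-1 - (phi c)^-1)).
  by rewrite /cosb /cosc; field; rewrite !gt_eqF.
have -> : (2 + (4 + L) * L) * (a / (c * phi a * phi c)) =
  (phi a)^-1 * (2 * a / c * (phi c)^-1 + (4 + L) * (a / c) * (L * (phi c)^-1)).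
  by field; rewrite !gt_eqF.
rewrite ler_pM2l//; apply: lerD.
  by rewrite ler_pM2r//; exact: cos_sum_le.
have cosc1 : cosc <= 1.
  by rewrite ler_pdivrMr ?mulr_gt0//; nra.
have d0 : 0 <= (phi b)^-1 - (phi c)^-1 by rewrite subr_ge0 inv_phi_le.
apply: (@le_trans _ _ ((phi b)^-1 - (phi c)^-1)); first by rewrite ler_piMl.
have -> : (phi b)^-1 - (phi c)^-1 = (phi c - phi b) * ((phi c)^-1 * (phi b)^-1).
  by field; rewrite !gt_eqF.
apply: (@le_trans _ _ ((4 + L) * (phi c / c) * (c - b) * ((phi c)^-1 * (phi b)^-1))).
  rewrite ler_pM2r ?mulr_gt0//; exact: (phi_increment_le Hphi L1 dbl).
have -> : (4 + L) * (phi c / c) * (c - b) * ((phi c)^-1 * (phi b)^-1) =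
   (4 + L) * ((c - b) / c) * (phi b)^-1.
  by field; rewrite !gt_eqF.
have L4 : 0 < 4 + L by rewrite addr_gt0.
apply: ler_pM => //; [|exact: ltW|].
  by rewrite mulr_ge0 ?(ltW L4)// divr_ge0 ?(ltW c0)// subr_ge0.
by rewrite ler_pM2l// ler_pM2r ?invr_gt0//; lra.
Qed.

(** Taking all ordered pairs of sides makes the bound symmetric, so that it is compatible with the
    reduction to [a <= b <= c]. *)
Definition pair_sum (f : R -> R -> R) a b c :=
  f a b + f b a + f a c + f c a + f b c + f c b.

(** [L] and [2 + (4 + L) * L] are the constants of [sym_kernel_ordered_le]; the factor [2 * L] is
    that of [hardy_term_exists]. *)
Definition upper_const := L + 2 * L * (2 + (4 + L) * L).

Lemma sym_kernel_le a b c : 0 <= a -> 0 <= b -> 0 <= c ->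
  c <= a + b -> b <= a + c -> a <= b + c ->
  exists i, sym_kernel eps a b c <=
    upper_const * pair_sum (fun u v => hardy_term 0 u v + hardy_term i u v) a b c.
Proof.
move: a b c; apply: triangle_wlog => [a b c H b0 a0 c0 h1 h2 h3|a b c H a0 c0 b0 h1 h2 h3|].
- rewrite sym_kernel_swap12; have [||||||i hi] := H => //; try lra.
  by exists i; rewrite [pair_sum _ _ _ _](_ : _ = pair_sum (fun u v => hardy_term 0 u v + hardy_term i u v) a b c)// /pair_sum; ring.
- rewrite sym_kernel_swap23; have [||||||i hi] := H => //; try lra.
  by exists i; rewrite [pair_sum _ _ _ _](_ : _ = pair_sum (fun u v => hardy_term 0 u v + hardy_term i u v) a b c)// /pair_sum; ring.
move=> a b c ab bc a0 b0 c0 cab _ _; have hL := L1; have L0 := lt_trans ltr01 L1.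
have LL : 0 <= (4 + L) * L by rewrite mulr_ge0 ?addr_ge0 ?(ltW L0).
have LLL : 0 <= 2 * L * (2 + (4 + L) * L) by rewrite !mulr_ge0 ?addr_ge0 ?(ltW L0).
have hg i u v := hardy_term_ge0 i u v.
have C0 : 0 <= upper_const by rewrite /upper_const addr_ge0 ?(ltW L0).
have pair_ge i : hardy_term 0 a c + hardy_term 0 b c + hardy_term i a c <=
    pair_sum (fun u v => hardy_term 0 u v + hardy_term i u v) a b c.
  rewrite /pair_sum; have := hg 0 a b; have := hg i a b; have := hg 0 b a; have := hg i b a.
  have := hg 0 c a; have := hg i c a; have := hg i b c; have := hg 0 c b; have := hg i c b.
  lra.
(* If [b <= eps], at most [c] exceeds [eps], so no angle has both its sides longer than [eps] and
   the kernel vanishes. *)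
have [be|eb] := leP b eps.
  exists 0%N; have -> : sym_kernel eps a b c = 0.
    rewrite /sym_kernel /angle_kernel [eps < b]ltNge be/= [eps < a]ltNge (le_trans ab be)/=.
    by rewrite andbF !addr0.
  by rewrite mulr_ge0 // /pair_sum !addr_ge0.
have b00 := lt_trans eps0 eb; have c00 := lt_le_trans b00 bc.
have ec := lt_le_trans eb bc.
have [pb pc] := (inv_phi_gt0 b00, inv_phi_gt0 c00).
have pbc : (phi b)^-1 <= L * (phi c)^-1.
  rewrite ler_pdivlMr ?(phi_gt0 Hphi)// mulrC ler_pdivrMr ?(phi_gt0 Hphi)//.
  by apply: (phi_le_dbl Hphi) => //; lra.
(* If [a <= eps < b], only the angle opposite [a] survives, and doubling bounds it by [L phi(c)^-2],
   a term of index 0. *)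
have [ae|ea] := leP a eps.
  exists 0%N; apply: le_trans (ler_wpM2l C0 (pair_ge 0%N)).
  have -> : sym_kernel eps a b c = angle_kernel eps a b c.
    by rewrite /sym_kernel /angle_kernel [eps < a]ltNge ae/= andbF !addr0.
  have h := @angle_kernel_le a b c; apply: (le_trans (h a0 _ _ eb ec)); [lra..|].
  apply: (@le_trans _ _ (L * hardy_term 0 b c)).
    by rewrite hardy_term0// expr2 mulrA ler_pM2r.
  have h1 := hg 0 a c; rewrite ler_pM ?(ltW L0)//; last by lra.
  by rewrite /upper_const lerDl.
have [i hi] := hardy_term_exists ea (le_trans ab bc).
exists i; apply: le_trans (ler_wpM2l C0 (pair_ge i)).
apply: (le_trans (sym_kernel_ordered_le ea ab bc cab)).
rewrite -(hardy_term0 ea (le_trans ab bc)) /upper_const.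
have h2 : 0 <= 2 + (4 + L) * L by lra.
have := ler_wpM2l h2 hi.
set K := 2 + (4 + L) * L in h2 LLL *; have h0 := hg 0 a c; have h3 := hg 0 b c; have h4 := hg i a c.
have := mulr_ge0 LLL h0; have := mulr_ge0 LLL h3; have := mulr_ge0 (ltW L0) h3.
have := mulr_ge0 (ltW L0) h4.
nra.
Qed.

End triangle_kernel.

(** * The symmetrized kernel for concave [phi]: lower bound *)

Section concave_kernel.
Context {R : realType} (phi : R -> R).
Hypothesis Hphi : class_Phi phi.
Hypothesis cphi : concave_phi phi.
Variables (eps L : R).
Hypothesis eps0 : 0 < eps.
Hypothesis L1 : 1 < L.
Hypothesis L2 : L < 2.
Hypothesis dbl : forall t, 0 <= t -> phi (2 * t) <= L * phi t.

(** Both [b] and [2a] lie between [a] and [a + b], with complementary weights: for [t = a / b],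
    [b = t a + (1 - t)(a + b)] and [2a = (1 - t) a + t (a + b)]. The two concavity inequalities add
    up to the claim. *)
Lemma concave_increment_le a b : 0 < a -> a <= b ->
  phi (a + b) - phi b <= phi (2 * a) - phi a.
Proof.
move=> a0 ab; have b0 := lt_le_trans a0 ab.
have t01 : Itv.spec (@Itv.num_sem R) (Itv.Real `[0%Z, 1%Z]) (a / b).
  by rewrite /Itv.num_sem/= num_real/= in_itv/= divr_ge0 ?(ltW a0) ?(ltW b0)//= ler_pdivrMr// mul1r.
have t01' : Itv.spec (@Itv.num_sem R) (Itv.Real `[0%Z, 1%Z]) (1 - a / b).
  rewrite /Itv.num_sem/= num_real/= in_itv/= subr_ge0 ler_pdivrMr// mul1r ab/=.
  by rewrite lerBlDr lerDl divr_ge0 ?ltW.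
have inD x : 0 <= x -> x \in (`[0, +oo[%classic : set R).
  by move=> x0; rewrite inE/= in_itv/= x0.
have ab0 : 0 <= a + b by rewrite addr_ge0 ?ltW.
have h1 := cphi (Itv.mk t01) (inD a (ltW a0)) (inD (a + b) ab0).
have h2 := cphi (Itv.mk t01') (inD a (ltW a0)) (inD (a + b) ab0).
have e1 : a / b * a + (1 - a / b) * (a + b) = b by field; rewrite gt_eqF.
have e2 : (1 - a / b) * a + (1 - (1 - a / b)) * (a + b) = 2 * a by field; rewrite gt_eqF.
have {}h1 : - phi b <= a / b * - phi a + (1 - a / b) * - phi (a + b).
  by rewrite -[in leLHS]e1; exact: h1.
have {}h2 : - phi (2 * a) <= (1 - a / b) * - phi a + (1 - (1 - a / b)) * - phi (a + b).
  by rewrite -[in leLHS]e2; exact: h2.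
move: h1 h2; set t := a / b; lra.
Qed.

(** Over the denominator [phi(a) phi(b) phi(c)] the numerator is [cosa phi(a) + (cosb + cosc) phi(c)
    - cosb (phi(c) - phi(b))]. The middle term is nonnegative. The subtracted one is at most
    [cosa (L - 1) phi(a)], since [0 <= cosb <= cosa]: a larger side faces a larger angle. There
    remains [(2 - L) cosa phi(a)], and [cosa >= 1/2] because the angle facing the shortest side is
    at most pi/3. *)
Lemma sym_kernel_ordered_ge a b c : eps < a -> a <= b -> b <= c -> c <= a + b ->
  (2 - L) / 2 * (phi c)^-1 ^+ 2 <= sym_kernel phi eps a b c.
Proof.
move=> ea ab bc cab; have a0 := lt_trans eps0 ea; have b0 := lt_le_trans a0 ab.
have c0 := lt_le_trans b0 bc; have hL := L1; have L0 := lt_trans ltr01 L1.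
have eb := lt_le_trans ea ab; have ec := lt_le_trans eb bc.
have [[pa pb] pc] := (inv_phi_gt0 Hphi a0, inv_phi_gt0 Hphi b0, inv_phi_gt0 Hphi c0).
have [[fa fb] fc] := (phi_gt0 Hphi a0, phi_gt0 Hphi b0, phi_gt0 Hphi c0).
rewrite /sym_kernel /angle_kernel ea eb ec/=.
set cosa := (b ^+ 2 + c ^+ 2 - a ^+ 2) / (2 * b * c).
set cosb := (c ^+ 2 + a ^+ 2 - b ^+ 2) / (2 * c * a).
set cosc := (a ^+ 2 + b ^+ 2 - c ^+ 2) / (2 * a * b).
rewrite [leRHS](_ : _ = (cosa * phi a + cosb * phi b + cosc * phi c) *
  ((phi a)^-1 * (phi b)^-1 * (phi c)^-1)); last first.
  by rewrite /cosa /cosb /cosc; field; rewrite !gt_eqF.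
have ab0 : 0 < a * b by rewrite mulr_gt0.
have ac0 : 0 < a * c by rewrite mulr_gt0.
have bc0 : 0 < b * c by rewrite mulr_gt0.
have abc0 : 0 < a * b * c by rewrite mulr_gt0.
have cosa_ge : 1 / 2 <= cosa by rewrite ler_pdivlMr ?mulr_gt0//; nra.
have cosb_ge : 0 <= cosb by rewrite divr_ge0 ?mulr_ge0 ?ltW//; nra.
have cosab : cosb <= cosa.
  rewrite -subr_ge0.
  have -> : cosa - cosb = (b - a) * ((a + b) ^+ 2 - c ^+ 2) / (2 * a * b * c).
    by rewrite /cosa /cosb; field; rewrite !gt_eqF.
  rewrite divr_ge0 ?mulr_ge0 ?(ltW a0) ?(ltW b0) ?(ltW c0)// subr_ge0// ler_sqr ?nnegrE// ltW//.
  by rewrite addr_gt0.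
have cosbc : 0 <= cosb + cosc.
  have -> : cosb + cosc = (b + c) * (a ^+ 2 - (c - b) ^+ 2) / (2 * a * b * c).
    by rewrite /cosb /cosc; field; rewrite !gt_eqF.
  rewrite divr_ge0 ?mulr_ge0 ?(ltW a0) ?(ltW b0) ?(ltW c0) ?(ltW (addr_gt0 b0 c0))//.
  by rewrite subr_ge0 ler_sqr ?nnegrE ?subr_ge0// ?(ltW a0)//; lra.
have inc : phi c - phi b <= (L - 1) * phi a.
  have : phi c <= phi (a + b) by apply: (phi_le Hphi) => //; exact: ltW.
  have := concave_increment_le a0 ab; have := dbl (ltW a0); lra.
have num : (2 - L) / 2 * phi a <= cosa * phi a + cosb * phi b + cosc * phi c.
  have h1 : 0 <= (cosb + cosc) * phi c by rewrite mulr_ge0 ?(ltW fc).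
  have h2 : cosb * (phi c - phi b) <= cosb * ((L - 1) * phi a) by rewrite ler_wpM2l.
  have h3 : cosb * ((L - 1) * phi a) <= cosa * ((L - 1) * phi a).
    by rewrite ler_wpM2r// mulr_ge0 ?(ltW fa)//; lra.
  have h4 : 1 / 2 * ((2 - L) * phi a) <= cosa * ((2 - L) * phi a).
    by rewrite ler_wpM2r// mulr_ge0 ?(ltW fa)//; have := L2; lra.
  lra.
have -> : (2 - L) / 2 * (phi c)^-1 ^+ 2 = (2 - L) / 2 * phi a * ((phi a)^-1 * (phi c)^-1 * (phi c)^-1).
  by field; rewrite !gt_eqF.
have cL : 0 <= (2 - L) / 2 by have := L2; lra.
apply: ler_pM => //.
- by rewrite mulr_ge0// ltW.
- by rewrite !mulr_ge0// ltW.
rewrite ler_pM2r// ler_pM2l//; exact: (inv_phi_le Hphi).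
Qed.

(** Set to 0 as soon as one side is at most [eps], where only the sign of the symmetrized kernel is
    used. *)
Definition lower_kernel a b c :=
  if [&& eps < a, eps < b & eps < c] then (phi (Num.max a (Num.max b c)))^-1 ^+ 2 else 0.

Lemma sym_kernel_ge a b c : 0 <= a -> 0 <= b -> 0 <= c ->
  c <= a + b -> b <= a + c -> a <= b + c ->
  (2 - L) / 2 * lower_kernel a b c <= sym_kernel phi eps a b c.
Proof.
move: a b c; apply: triangle_wlog => [a b c H b0 a0 c0 h1 h2 h3|a b c H a0 c0 b0 h1 h2 h3|].
- rewrite sym_kernel_swap12 /lower_kernel maxA (maxC b) -maxA andbCA.
  by apply: H => //; lra.
- rewrite sym_kernel_swap23 /lower_kernel (maxC c) (andbC (eps < c)).
  by apply: H => //; lra.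
move=> a b c ab bc a0 b0 c0 cab _ _; rewrite /lower_kernel.
have [ea|ae]/= := ltP eps a.
  rewrite (lt_le_trans ea ab) (lt_le_trans ea (le_trans ab bc))/=.
  by rewrite (max_idPr bc) (max_idPr (le_trans ab bc)) sym_kernel_ordered_ge.
(* Only the angle facing the shortest side [a] can survive the truncation, and it is acute. *)
rewrite mulr0 /sym_kernel /angle_kernel [eps < a]ltNge ae/= andbF !addr0.
case: ifP => // /andP[eb ec].
have {}b0 := lt_trans eps0 eb; have {}c0 := lt_trans eps0 ec.
apply: divr_ge0; last by rewrite ?mulr_ge0 ?(ltW b0) ?(ltW c0) ?(ltW (phi_gt0 Hphi _)).
nra.
Qed.

End concave_kernel.

(** * Triple integrals *)

Section tri.
Local Open Scope ereal_scope.
Context {d : measure_display} {T : measurableType d} {R : realType}.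
Variable nu : {finite_measure set T -> \bar R}.
Implicit Type K : T -> T -> T -> \bar R.

Definition uncurry3 K (w : T * T * T) := K w.1.1 w.1.2 w.2.

Definition mfun3 K := @measurable_fun _ _ (T * T * T)%type (\bar R) setT (uncurry3 K).

Definition tri K := \int[nu]_x \int[nu]_y \int[nu]_z K x y z.

Lemma mfun3_perm (s : T * T * T -> T * T * T) K K' :
  measurable_fun setT s -> uncurry3 K' = uncurry3 K \o s -> mfun3 K -> mfun3 K'.
Proof. by move=> ms e mK; rewrite /mfun3 e; exact: measurableT_comp. Qed.

Lemma measurable_swap12 : measurable_fun setT (fun w : T * T * T => (w.1.2, w.1.1, w.2)).
Proof.
by repeat apply: measurable_fun_pair => //; apply: measurableT_comp => //.
Qed.

Lemma measurable_swap23 : measurable_fun setT (fun w : T * T * T => (w.1.1, w.2, w.1.2)).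
Proof.
by repeat apply: measurable_fun_pair => //; apply: measurableT_comp => //.
Qed.

Lemma mfun3_swap12 K : mfun3 K -> mfun3 (fun x y z => K y x z).
Proof. exact: mfun3_perm measurable_swap12 _. Qed.

Lemma mfun3_swap23 K : mfun3 K -> mfun3 (fun x y z => K x z y).
Proof. exact: mfun3_perm measurable_swap23 _. Qed.

Lemma mfun3_z K x y : mfun3 K -> measurable_fun setT (K x y).
Proof.
move=> mK; have h : measurable_fun setT (fun z : T => (x, y, z)) by exact: measurable_fun_pair.
exact: (measurableT_comp mK h).
Qed.

Lemma mfun3_yz K x : mfun3 K -> measurable_fun setT (fun w : T * T => K x w.1 w.2).
Proof.
move=> mK; have h : measurable_fun setT (fun w : T * T => (x, w.1, w.2)).
  by repeat apply: measurable_fun_pair => //.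
exact: (measurableT_comp mK h).
Qed.

Lemma measurable_int1 K x : mfun3 K -> (forall x y z, 0 <= K x y z) ->
  measurable_fun setT (fun y => \int[nu]_z K x y z).
Proof.
by move=> mK K0; apply: (measurable_fun_fubini_tonelli_F (fun w => K x w.1 w.2)) => //;
  exact: mfun3_yz.
Qed.

Lemma measurable_int2 K : mfun3 K -> (forall x y z, 0 <= K x y z) ->
  measurable_fun setT (fun x => \int[nu]_y \int[nu]_z K x y z).
Proof.
move=> mK K0; apply: (measurable_fun_fubini_tonelli_F (fun w => \int[nu]_z K w.1 w.2 z)) => //.
  by apply: (measurable_fun_fubini_tonelli_F (uncurry3 K)) => // w; exact: K0.
by move=> w; exact: integral_ge0.
Qed.

Lemma eq_tri K K' : (forall x y z, K x y z = K' x y z) -> tri K = tri K'.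
Proof.
by move=> e; do 3 (apply: eq_integral => ? _); exact: e.
Qed.

Lemma tri_swap23 K : mfun3 K -> (forall x y z, 0 <= K x y z) ->
  tri (fun x y z => K x z y) = tri K.
Proof.
move=> mK K0; apply: eq_integral => x _.
rewrite (fubini_tonelli (m1 := nu) (m2 := nu) (fun w => K x w.2 w.1))//.
exact: (@mfun3_yz (fun x y z => K x z y) x (mfun3_swap23 mK)).
Qed.

Lemma tri_swap12 K : mfun3 K -> (forall x y z, 0 <= K x y z) ->
  tri (fun x y z => K y x z) = tri K.
Proof.
move=> mK K0; rewrite /tri.
rewrite (fubini_tonelli (m1 := nu) (m2 := nu) (fun w => \int[nu]_z K w.2 w.1 z))//.
  apply: (measurable_fun_fubini_tonelli_F (fun w => K w.1.2 w.1.1 w.2)) => //.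
  exact: mfun3_swap12.
by move=> w; exact: integral_ge0.
Qed.

Lemma le_tri K K' : mfun3 K -> mfun3 K' -> (forall x y z, 0 <= K x y z) ->
  (forall x y z, K x y z <= K' x y z) -> tri K <= tri K'.
Proof.
move=> mK mK' K0 KK'; have K'0 x y z : 0 <= K' x y z := le_trans (K0 x y z) (KK' x y z).
apply: ge0_le_integral => //; [|exact: measurable_int2..|].
  by move=> x _; apply: integral_ge0 => y _; exact: integral_ge0.
move=> x _; apply: ge0_le_integral => //; [|exact: measurable_int1..|].
  by move=> y _; exact: integral_ge0.
by move=> y _; apply: ge0_le_integral => //; exact: mfun3_z.
Qed.

Lemma triD K K' : mfun3 K -> mfun3 K' -> (forall x y z, 0 <= K x y z) ->
  (forall x y z, 0 <= K' x y z) -> tri (fun x y z => K x y z + K' x y z) = tri K + tri K'.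
Proof.
move=> mK mK' K0 K'0; rewrite /tri -ge0_integralD//;
  [|by move=> x _; apply: integral_ge0 => y _; exact: integral_ge0|exact: measurable_int2
   |by move=> x _; apply: integral_ge0 => y _; exact: integral_ge0|exact: measurable_int2].
apply: eq_integral => x _; rewrite -ge0_integralD//;
  [|by move=> y _; exact: integral_ge0|exact: measurable_int1
   |by move=> y _; exact: integral_ge0|exact: measurable_int1].
by apply: eq_integral => y _; rewrite ge0_integralD//; exact: mfun3_z.
Qed.

Lemma triZ (c : R) K : mfun3 K -> (0 <= c)%R -> (forall x y z, 0 <= K x y z) ->
  tri (fun x y z => c%:E * K x y z) = c%:E * tri K.
Proof.
move=> mK c0 K0; rewrite /tri -ge0_integralZl//;
  [|exact: measurable_int2|by move=> x _; apply: integral_ge0 => y _; exact: integral_ge0].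
apply: eq_integral => x _; rewrite -ge0_integralZl//;
  [|exact: measurable_int1|by move=> y _; exact: integral_ge0].
by apply: eq_integral => y _; rewrite ge0_integralZl//; exact: mfun3_z.
Qed.

Lemma tri_nneseries (K : nat -> T -> T -> T -> \bar R) :
  (forall i, mfun3 (K i)) -> (forall i x y z, 0 <= K i x y z) ->
  tri (fun x y z => \sum_(0 <= i <oo) K i x y z) = \sum_(0 <= i <oo) tri (K i).
Proof.
move=> mK K0; rewrite /tri -integral_nneseries//;
  [|move=> i; exact: measurable_int2
   |by move=> i x _; apply: integral_ge0 => y _; exact: integral_ge0].
apply: eq_integral => x _; rewrite -integral_nneseries//;
  [|move=> i; exact: measurable_int1|by move=> i y _; exact: integral_ge0].
by apply: eq_integral => y _; rewrite integral_nneseries// => i; exact: mfun3_z.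
Qed.

Lemma tri_rot1 K : mfun3 K -> (forall x y z, 0 <= K x y z) ->
  tri (fun x y z => K y z x) = tri K.
Proof.
move=> mK K0; apply: etrans (tri_swap23 mK K0).
exact: (tri_swap12 (mfun3_swap23 mK)).
Qed.

Lemma tri_rot2 K : mfun3 K -> (forall x y z, 0 <= K x y z) ->
  tri (fun x y z => K z x y) = tri K.
Proof.
move=> mK K0; apply: etrans (tri_swap12 mK K0).
exact: (tri_swap23 (mfun3_swap12 mK)).
Qed.

Lemma mfun3_rot1 K : mfun3 K -> mfun3 (fun x y z => K y z x).
Proof. by move/mfun3_swap23/mfun3_swap12. Qed.

Lemma mfun3_rot2 K : mfun3 K -> mfun3 (fun x y z => K z x y).
Proof. by move/mfun3_swap12/mfun3_swap23. Qed.

Lemma mfun3D K K' : mfun3 K -> mfun3 K' -> mfun3 (fun x y z => K x y z + K' x y z).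
Proof. by move=> mK mK'; exact: emeasurable_funD. Qed.

Lemma tri_rotations K : mfun3 K -> (forall x y z, 0 <= K x y z) ->
  tri (fun x y z => K x y z + K y z x + K z x y) = tri K + tri K + tri K.
Proof.
move=> mK K0; have [mK1 mK2] := (mfun3_rot1 mK, mfun3_rot2 mK).
have K01 x y z : 0 <= K x y z + K y z x by rewrite adde_ge0.
apply: etrans (triD (mfun3D mK mK1) mK2 K01 (fun x y z => K0 z x y)) _.
rewrite (tri_rot2 mK K0); congr (_ + _).
by apply: etrans (triD mK mK1 K0 (fun x y z => K0 y z x)) _; rewrite (tri_rot1 mK K0).
Qed.

(** Six terms rather than three, for kernels that are not symmetric in their last two arguments, as
    is the case of [hardy_term]. *)
Lemma tri_permutations K : mfun3 K -> (forall x y z, 0 <= K x y z) ->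
  tri (fun x y z => (K x y z + K y z x + K z x y) + (K x z y + K y x z + K z y x)) =
  (tri K + tri K + tri K) + (tri K + tri K + tri K).
Proof.
move=> mK K0; have [mK1 mK2] := (mfun3_rot1 mK, mfun3_rot2 mK).
have mK' := mfun3_swap23 mK; have [mK'1 mK'2] := (mfun3_rot1 mK', mfun3_rot2 mK').
have m3 := mfun3D (mfun3D mK mK1) mK2; have m3' := mfun3D (mfun3D mK' mK'1) mK'2.
have K03 x y z : 0 <= K x y z + K y z x + K z x y by rewrite !adde_ge0.
have K03' x y z : 0 <= K x z y + K y x z + K z y x by rewrite !adde_ge0.
apply: etrans (triD m3 m3' K03 K03') _.
rewrite (tri_rotations mK K0) -(tri_swap23 mK K0); congr (_ + _).
exact: (tri_rotations mK').
Qed.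

End tri.

(** * The Wolff weight *)

Section derivative_continuous.
Context {R : realType}.
Implicit Types (g : R -> R) (t e : R).

Lemma slope_cvg g t : derivable g t 1 ->
  h^-1 * (g (h + t) - g t) @[h --> 0^'] --> derive1 g t.
Proof.
move=> dg.
have -> : (fun h => h^-1 * (g (h + t) - g t)) =
    (fun h => h^-1 *: ((g \o shift t) (h *: (1 : R)) - g t)).
  by apply/funext => h /=; rewrite /shift /= [h *: 1]mulr1.
by rewrite derive1E; exact: dg.
Qed.

Lemma exists_near_slope g t e : derivable g t 1 -> 0 < t -> 0 < e ->
  exists w u, [/\ 0 < w < t, t < u, (g u - g t) / (u - t) < derive1 g t + e &
                  derive1 g t - e < (g t - g w) / (t - w)].
Proof.
move=> dg t0 e0.
have /cvgrPdist_lt/(_ _ e0)/= Hr := cvg_dnbhs_at_right (slope_cvg dg).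
have /cvgrPdist_lt/(_ _ e0)/= Hl := cvg_dnbhs_at_left (slope_cvg dg).
have [u [u0 hu]] : exists u, 0 < u /\ `|derive1 g t - u^-1 * (g (u + t) - g t)| < e.
  near (0 : R)^'+ => u; exists u; split; near: u => //; exact: nbhs_right_gt.
have [w [w0 wt hw]] : exists w, [/\ w < 0, - t < w & `|derive1 g t - w^-1 * (g (w + t) - g t)| < e].
  near (0 : R)^'- => w; exists w; split; near: w => //; first exact: nbhs_left_lt.
  by apply: nbhs_left_gt; rewrite oppr_lt0.
exists (w + t), (u + t); split; [lra|lra| |].
- have -> : (g (u + t) - g t) / (u + t - t) = u^-1 * (g (u + t) - g t) by rewrite addrK mulrC.
  by move: hu; rewrite ltr_norml => /andP[]; lra.
- have -> : (g t - g (w + t)) / (t - (w + t)) = w^-1 * (g (w + t) - g t).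
    by field; rewrite lt_eqF// -oppr_eq0; lra.
  by move: hw; rewrite ltr_norml => /andP[]; lra.
Unshelve. all: by end_near. Qed.

(* The difference quotients towards a fixed right (resp. left) endpoint bound
   a nondecreasing derivative from above (resp. below), and they are continuous
   in the other endpoint. *)
Lemma nondecreasing_derive1_continuous g :
  (forall t, 0 < t -> derivable g t 1) ->
  {in Num.pos &, {homo derive1 g : t u / t <= u}} ->
  forall t, 0 < t -> {for t, continuous (derive1 g)}.
Proof.
move=> dg mono t t0.
have cg x : 0 < x -> {for x, continuous g}.
  by move=> x0; apply/differentiable_continuous/derivable1_diffP/dg.
have mvt b c : 0 < b -> b < c -> derive1 g b <= (g c - g b) / (c - b) <= derive1 g c.
  move=> b0 bc; have [x xbc e] : exists2 x, x \in `]b, c[ & g c - g b = derive1 g x * (c - b).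
    apply: MVT bc _ _ => [x|].
      rewrite in_itv/= => /andP[bx _]; rewrite derive1E.
      by apply/derivableP/dg/(lt_trans b0).
    apply: continuous_in_subspaceT => x; rewrite inE/= in_itv/= => /andP[bx _].
    exact/cg/(lt_le_trans b0).
  move: xbc; rewrite in_itv/= => /andP[bx xc].
  rewrite e mulfK ?subr_eq0 ?gt_eqF//.
  by rewrite !mono ?posrE ?ltW// ?(lt_trans b0)// (lt_trans bx).
apply/cvgrPdist_lt => e e0.
have [w [u [/andP[w0 wt] tu hu hw]]] := exists_near_slope (dg _ t0) t0 e0.
have cu : (g u - g x) / (u - x) @[x --> t] --> (g u - g t) / (u - t).
  apply: cvgM; first by apply: cvgB; [exact: cvg_cst|exact: cg].
  by apply: cvgV; [rewrite subr_eq0 gt_eqF|apply: cvgB; [exact: cvg_cst|exact: cvg_id]].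
have cw : (g x - g w) / (x - w) @[x --> t] --> (g t - g w) / (t - w).
  apply: cvgM; first by apply: cvgB; [exact: cg|exact: cvg_cst].
  by apply: cvgV; [rewrite subr_eq0 gt_eqF|apply: cvgB; [exact: cvg_id|exact: cvg_cst]].
near=> x.
have xu : x < u by near: x; exact: lt_nbhsl.
have wx : w < x by near: x; exact: lt_nbhsr.
have x0 : 0 < x := lt_trans w0 wx.
have /andP[h1 _] := mvt _ _ x0 xu; have /andP[_ h2] := mvt _ _ w0 wx.
have h3 : (g u - g x) / (u - x) < derive1 g t + e.
  by near: x; exact: (cvgr_lt _ cu).
have h4 : derive1 g t - e < (g x - g w) / (x - w).
  by near: x; exact: (cvgr_gt _ cw).
rewrite ltr_norml; apply/andP; split; lra.
Unshelve. all: by end_near. Qed.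

(** Continuity of [phi'] makes the Wolff weight measurable and admissible in the fundamental theorem
    of calculus. A nonincreasing derivative is treated through [- phi]. *)
Lemma derive1_phi_continuous (phi : R -> R) (Hphi : class_Phi phi) t :
  0 < t -> {for t, continuous (derive1 phi)}.
Proof.
have d := class_Phi_derivable Hphi.
case: (class_Phi_monotonic Hphi) => mono t0.
  exact: nondecreasing_derive1_continuous.
have dN x : 0 < x -> derivable (- phi) x 1 by move=> x0; exact/derivableN/d.
have h : {for t, continuous (derive1 (- phi))}.
  apply: nondecreasing_derive1_continuous => // x y x0 y0 xy.
  by rewrite !derive1N ?lerN2 ?mono//; apply: d; rewrite -posrE.
have : {for t, continuous (- derive1 (- phi))} by apply: continuousN.
rewrite /prop_for /continuous_at => H.
have e x : 0 < x -> derive1 phi x = (- derive1 (- phi)) x.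
  by move=> x0; rewrite fctE derive1N ?opprK//; exact: d.
rewrite (e _ t0); apply: cvg_trans H; apply: near_eq_cvg.
by near=> x; rewrite e//; near: x; exact: lt_nbhsr.
Unshelve. all: by end_near. Qed.

End derivative_continuous.

(** [phi] is arbitrary on negative arguments and may jump at 0, so measurability is derived from
    continuity on an open half-line only. *)
Lemma measurable_truncation {R : realType} (a : R) (f : R -> R) :
  (forall t, a < t -> {for t, continuous f}) ->
  measurable_fun setT (fun t => if a < t then f t else 0).
Proof.
move=> cf; have m : measurable_fun (`]a, +oo[%classic : set R) f.
  apply: open_continuous_measurable_fun => // t.
  rewrite inE/= in_itv/= andbT; exact: cf.
have -> : (fun t => if a < t then f t else 0) = f \_ (`]a, +oo[%classic : set R).
  by apply/funext => t; rewrite patchE mem_setE in_itv/= andbT.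
by apply/(measurable_restrictT _ _).1.
Qed.

Section wolff_weight.
Context {R : realType} (phi : R -> R).
Hypothesis Hphi : class_Phi phi.

Lemma derive1_phi_ge0 t : 0 < t -> 0 <= derive1 phi t.
Proof.
move=> t0; apply: (@incr_derive1_ge0_itvy _ phi true 0).
- move=> x; rewrite inE/= in_itv/= andbT; exact: (class_Phi_derivable Hphi).
- move=> x y; rewrite !in_itv/= !andbT => x0 _; exact: (phi_lt Hphi).
- by rewrite in_itv/= andbT.
Qed.

(** The derivative of [- phi^-2 / 2]; the Wolff potential integrates the squared measure of the
    balls against it. The value 0 for [t <= 0] lets integrals run over the whole line. *)
Definition wolff_weight t : R :=
  if 0 < t then derive1 phi t * (phi t)^-1 ^+ 3 else 0.

Lemma wolff_weight_ge0 t : 0 <= wolff_weight t.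
Proof.
rewrite /wolff_weight; case: ifP => // t0.
by rewrite mulr_ge0 ?derive1_phi_ge0// exprn_ge0// invr_ge0 ltW// (phi_gt0 Hphi).
Qed.

Lemma wolff_weight_continuous t : 0 < t -> {for t, continuous wolff_weight}.
Proof.
move=> t0; have h : {for t, continuous (fun t => derive1 phi t * (phi t)^-1 ^+ 3)}.
  apply: continuousM; first exact: derive1_phi_continuous.
  apply: (@continuous_comp _ _ _ (fun t => (phi t)^-1) (fun t => t ^+ 3)).
    apply: continuousV; first by rewrite gt_eqF// (phi_gt0 Hphi).
    exact: (phi_continuous Hphi).
  exact: exprn_continuous.
rewrite /prop_for /continuous_at {2}/wolff_weight t0; apply: cvg_trans h.
apply: near_eq_cvg; near=> x; rewrite /wolff_weight ifT//.
by near: x; exact: lt_nbhsr.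
Unshelve. all: by end_near. Qed.

Lemma measurable_wolff_weight : measurable_fun setT wolff_weight.
Proof.
have -> : wolff_weight = (fun t => if 0 < t then wolff_weight t else 0).
  by apply/funext => t; rewrite /wolff_weight; case: ifP.
by apply: measurable_truncation => t; exact: wolff_weight_continuous.
Qed.

Lemma integral_wolff_weight a : 0 < a ->
  (\int[lebesgue_measure]_(t in `]a, +oo[) (wolff_weight t)%:E =
   (2^-1 * (phi a)^-1 ^+ 2)%:E)%E.
Proof.
move=> a0; rewrite integral_itv_obnd_cbnd; last first.
  by apply/measurable_EFinP; apply: measurable_funS measurable_wolff_weight.
pose F t := - (2^-1 * (phi t)^-1 ^+ 2).
have dF (x : R) : 0 < x -> is_derive x 1 F (wolff_weight x).
  move=> x0; have px := phi_gt0 Hphi x0.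
  have d : is_derive x 1 phi (derive1 phi x).
    by rewrite derive1E; apply/derivableP/(class_Phi_derivable Hphi).
  have dV := is_deriveV (lt0r_neq0 px) d.
  have dX := is_deriveX 2 dV.
  have dZ := is_deriveZ (2^-1) dX.
  have dN := is_deriveN dZ.
  apply: is_derive_eq dN _.
  rewrite /wolff_weight x0 /GRing.scale/=.
  by field; rewrite gt_eqF.
rewrite (@ge0_continuous_FTC2y _ wolff_weight F a 0).
- by rewrite sub0e /F -EFinN opprK.
- by move=> x _; exact: wolff_weight_ge0.
- apply: continuous_in_subspaceT => x; rewrite inE/= in_itv/= andbT => ax.
  exact/wolff_weight_continuous/(lt_le_trans a0).
(* The boundary term at infinity vanishes because [phi] tends to infinity. *)
- rewrite -oppr0; apply: cvgN.
  rewrite -(mulr0 (2^-1)); apply: cvgMr.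
  rewrite -[X in _ --> X](expr0n _ 2).
  apply: (@cvg_comp _ _ _ (fun t => (phi t)^-1) (fun t => t ^+ 2)).
    have pos : \forall t \near +oo, 0 < (phi t)^-1.
      by near=> t; rewrite invr_gt0 (phi_gt0 Hphi).
    apply/(cvgrVy pos).
      rewrite (_ : unstable.inv_fun _ = phi); first exact: (class_Phi_pinfty Hphi).
      by apply/funext => t; rewrite /unstable.inv_fun/= invrK.
  exact: exprn_continuous.
- by move=> x ax; have [] := dF x (lt_trans a0 ax).
- apply: cvg_at_right_filter.
  have [+ _] := dF a a0.
  by move=> /derivable1_diffP/differentiable_continuous.
- move=> x; rewrite in_itv/= andbT => ax.
  by rewrite derive1E; have := dF x (lt_trans a0 ax) => h; rewrite derive_val.
Unshelve. all: by end_near. Qed.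

End wolff_weight.

(** * Layer cake and a Hardy-type inequality *)

Section layer_cake.
Local Open Scope ereal_scope.
Context {d : measure_display} {T : measurableType d} {R : realType}.
Variable nu : {finite_measure set T -> \bar R}.
Notation leb := (@lebesgue_measure R).

(** At each level [t] the integrand is a product in [y] and [z]. This serves both for the balls of
    the Wolff potential and for the superlevel sets of the layer cake formula. *)
Lemma integral_layers (w : R -> R) (k l : T -> R -> R) :
  measurable_fun setT w ->
  measurable_fun setT (fun p : T * R => k p.1 p.2) ->
  measurable_fun setT (fun p : T * R => l p.1 p.2) ->
  (forall t, (0 <= w t)%R) -> (forall y t, (0 <= k y t)%R) -> (forall z t, (0 <= l z t)%R) ->
  \int[nu]_y \int[nu]_z \int[leb]_t (w t * (k y t * l z t))%:E =
  \int[leb]_t ((w t)%:E * (\int[nu]_y (k y t)%:E * \int[nu]_z (l z t)%:E)).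
Proof.
move=> mw mk ml w0 k0 l0.
have mkt t : measurable_fun setT (k ^~ t) by exact: measurableT_comp mk (pair2_measurable t).
have mlt t : measurable_fun setT (l ^~ t) by exact: measurableT_comp ml (pair2_measurable t).
have mky y : measurable_fun setT (k y) by exact: measurableT_comp mk (pair1_measurable y).
have mly y : measurable_fun setT (l y) by exact: measurableT_comp ml (pair1_measurable y).
pose L t := \int[nu]_z (l z t)%:E.
have L0 t : 0 <= L t by apply: integral_ge0 => z _; rewrite lee_fin.
have mL : measurable_fun setT L.
  apply: (measurable_fun_fubini_tonelli_G (m1 := nu) (fun p : T * R => (l p.1 p.2)%:E)).
    exact/measurable_EFinP.
  by move=> p; rewrite lee_fin.
have inner y : \int[nu]_z \int[leb]_t (w t * (k y t * l z t))%:E =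
    \int[leb]_t ((w t * k y t)%:E * L t).
  rewrite (fubini_tonelli (m1 := nu) (m2 := leb) (fun p => (w p.2 * (k y p.2 * l p.1 p.2))%:E)).
  - apply: eq_integral => t _; rewrite -ge0_integralZl//.
    + by apply: eq_integral => z _; rewrite -EFinM mulrA.
    + exact/measurable_EFinP.
    + by move=> z _; rewrite lee_fin.
    + by rewrite lee_fin mulr_ge0.
  - apply/measurable_EFinP; apply: measurable_funM; first exact: measurableT_comp mw _.
    by apply: measurable_funM => //; exact: measurableT_comp (mky y) _.
  - by move=> p; rewrite lee_fin !mulr_ge0.
under eq_integral do rewrite inner.
rewrite (fubini_tonelli (m1 := nu) (m2 := leb) (fun p => (w p.2 * k p.1 p.2)%:E * L p.2)).
- apply: eq_integral => t _ /=; rewrite ge0_integralZr//.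
  + rewrite muleA; congr (_ * _); rewrite -ge0_integralZl//.
    * exact/measurable_EFinP.
    * by move=> y _; rewrite lee_fin.
    * by rewrite lee_fin.
  + by apply/measurable_EFinP; apply: measurable_funM => //; exact: measurable_cst.
  + by move=> y _; rewrite lee_fin mulr_ge0.
- apply: emeasurable_funM; last exact: measurableT_comp mL _.
  apply/measurable_EFinP; apply: measurable_funM => //; exact: measurableT_comp mw _.
- by move=> p; rewrite mule_ge0// lee_fin mulr_ge0.
Qed.

Definition layer (g : T -> R) y t : R := ((0 < t) && (t < g y))%R%:R.

Lemma measurable_layer (g : T -> R) : measurable_fun setT g ->
  measurable_fun setT (fun p : T * R => layer g p.1 p.2).
Proof.
move=> mg; apply: (measurableT_comp (f := fun b : bool => b%:R : R)) => //.
apply: measurable_and; apply: measurable_fun_ltr => //; exact: measurableT_comp mg _.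
Qed.

(** [min (g y) (h z)] is the length of the set of [t > 0] lying below both values, a condition that
    separates [y] from [z]. *)
Lemma integral_layer (g h : T -> R) : measurable_fun setT g -> measurable_fun setT h ->
  (forall y, (0 <= g y)%R) -> (forall y, (0 <= h y)%R) ->
  \int[nu]_y \int[nu]_z (Num.min (g y) (h z))%:E =
  \int[leb]_t (\int[nu]_y (layer g y t)%:E * \int[nu]_y (layer h y t)%:E).
Proof.
move=> mg mh g0 h0.
have -> : \int[leb]_t (\int[nu]_y (layer g y t)%:E * \int[nu]_y (layer h y t)%:E) =
    \int[leb]_t (1%:E * (\int[nu]_y (layer g y t)%:E * \int[nu]_y (layer h y t)%:E)).
  by apply: eq_integral => t _; rewrite mul1e.
rewrite -(@integral_layers (cst 1%R) (layer g) (layer h)); [|by []|exact: measurable_layer|exact: measurable_layer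
  |by []|by move=> y t; exact: ler0n|by move=> y t; exact: ler0n].
apply: eq_integral => y _; apply: eq_integral => z _.
have -> : (fun t => (cst 1%R t * (layer g y t * layer h z t))%:E) =
    (fun t => (\1_`]0%R, Num.min (g y) (h z)[%classic t)%:E).
  apply/funext => t; rewrite /layer mul1r -natrM mulnb indicE.
  congr (_%:R%:E); rewrite mem_setE in_itv/= lt_min.
  by case: (0 < t)%R.
rewrite integral_indic// setIT [RHS](lebesgue_measure_itv `]0%R, Num.min (g y) (h z)[)/= lte_fin.
have m0 : (0 <= Num.min (g y) (h z))%R by rewrite le_min g0 h0.
case: ifPn => [_|]; first by rewrite sube0.
by rewrite -leNgt => m1; congr (_%:E); apply/eqP; rewrite eq_le m0 m1.
Qed.

(** At level [t] the integrand is a product of distribution functions [N g t] and [N h t], finite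
    since [nu] is, and [ab <= (c/2) a^2 + b^2 / (2c)]. *)
Lemma integral_min_AMGM (c : R) (g h : T -> R) : (0 < c)%R ->
  measurable_fun setT g -> measurable_fun setT h ->
  (forall y, (0 <= g y)%R) -> (forall y, (0 <= h y)%R) ->
  \int[nu]_y \int[nu]_z (Num.min (g y) (h z))%:E <=
  (c / 2)%:E * \int[nu]_y \int[nu]_z (Num.min (g y) (g z))%:E +
  ((2 * c)^-1)%:E * \int[nu]_y \int[nu]_z (Num.min (h y) (h z))%:E.
Proof.
move=> c0 mg mh g0 h0; rewrite !integral_layer//.
pose N (f : T -> R) t := \int[nu]_y (layer f y t)%:E.
have N0 f t : 0 <= N f t by apply: integral_ge0 => y _; rewrite lee_fin ler0n.
have mN f : measurable_fun setT f -> measurable_fun setT (N f).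
  move=> mf; apply: (measurable_fun_fubini_tonelli_G (m1 := nu) (fun p : T * R => (layer f p.1 p.2)%:E)).
    by apply/measurable_EFinP; exact: measurable_layer.
  by move=> p; rewrite lee_fin ler0n.
have Nfin f t : measurable_fun setT f -> N f t \is a fin_num.
  move=> mf; rewrite ge0_fin_numE//.
  apply: (@le_lt_trans _ _ (\int[nu]_y 1%:E)).
    apply: ge0_le_integral => //.
    - by move=> y _; rewrite lee_fin ler0n.
    - apply/measurable_EFinP; exact: measurableT_comp (measurable_layer mf) (pair2_measurable t).
    - by move=> y _; rewrite lee_fin /layer; case: (_ && _); rewrite ?ler01.
  by rewrite integral_cst// mul1e ltey_eq fin_num_measure.
have NN0 f f' t : 0 <= N f t * N f' t by rewrite mule_ge0.
rewrite -ge0_integralZl//; last 3 first.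
- by apply: emeasurable_funM; exact: mN.
- by move=> t _; exact: NN0.
- by rewrite lee_fin divr_ge0 ?(ltW c0).
rewrite -ge0_integralZl//; last 3 first.
- by apply: emeasurable_funM; exact: mN.
- by move=> t _; exact: NN0.
- by rewrite lee_fin invr_ge0 mulr_ge0 ?(ltW c0).
rewrite -ge0_integralD//; last 4 first.
- by move=> t _; apply: mule_ge0; [rewrite lee_fin divr_ge0 ?(ltW c0)|exact: NN0].
- by apply: measurable_funeM; apply: emeasurable_funM; exact: mN.
- by move=> t _; apply: mule_ge0; [rewrite lee_fin invr_ge0 mulr_ge0 ?(ltW c0)|exact: NN0].
- by apply: measurable_funeM; apply: emeasurable_funM; exact: mN.
apply: ge0_le_integral => //.
- by move=> t _; exact: NN0.
- by apply: emeasurable_funM; exact: mN.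
- by apply: emeasurable_funD; apply: measurable_funeM; apply: emeasurable_funM; exact: mN.
move=> t _; rewrite -/(N g t) -/(N h t).
rewrite -(fineK (Nfin g t mg)) -(fineK (Nfin h t mh)) -!EFinM -EFinD lee_fin.
set a := fine _; set b := fine _.
rewrite -subr_ge0 [leRHS](_ : _ = (c * a - b) ^+ 2 / (2 * c))%R.
  by rewrite divr_ge0 ?sqr_ge0// mulr_ge0 ?(ltW c0).
by field; rewrite gt_eqF.
Qed.

(** AM-GM with weight [c] balances the two sides: [f] contributes [c / 2], and [c^2 f] contributes
    [c^2 / (2c) = c / 2]. A pointwise estimate would lose [c^2] for [c > 1]. *)
Lemma integral_min_scale (c : R) (f : T -> R) : (0 < c)%R ->
  measurable_fun setT f -> (forall y, (0 <= f y)%R) ->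
  \int[nu]_y \int[nu]_z (Num.min (f y) (c ^+ 2 * f z))%:E <=
  c%:E * \int[nu]_y \int[nu]_z (Num.min (f y) (f z))%:E.
Proof.
move=> c0 mf f0; have c20 : (0 <= c ^+ 2)%R by exact: sqr_ge0.
have mcf : measurable_fun setT (fun z => c ^+ 2 * f z)%R by exact: measurable_funM.
have I0 : 0 <= \int[nu]_y \int[nu]_z (Num.min (f y) (f z))%:E.
  by apply: integral_ge0 => y _; apply: integral_ge0 => z _; rewrite lee_fin le_min !f0.
apply: (le_trans (integral_min_AMGM c0 mf mcf f0 _)).
  by move=> y; rewrite mulr_ge0.
have -> : \int[nu]_y \int[nu]_z (Num.min (c ^+ 2 * f y) (c ^+ 2 * f z))%:E =
    (c ^+ 2)%:E * \int[nu]_y \int[nu]_z (Num.min (f y) (f z))%:E.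
  have mm y : measurable_fun setT (fun z => (Num.min (f y) (f z))%:E).
    by apply/measurable_EFinP; apply: measurable_minr.
  rewrite -ge0_integralZl//; last 2 first.
  - apply: (measurable_fun_fubini_tonelli_F (m2 := nu) (fun p : T * T => (Num.min (f p.1) (f p.2))%:E)).
      apply/measurable_EFinP; apply: measurable_minr; exact: measurableT_comp mf _.
    by move=> p; rewrite lee_fin le_min !f0.
  - by move=> y _; apply: integral_ge0 => z _; rewrite lee_fin le_min !f0.
  apply: eq_integral => y _; rewrite -ge0_integralZl//; last first.
    by move=> z _; rewrite lee_fin le_min !f0.
  by apply: eq_integral => z _; rewrite -EFinM minr_pMr.
rewrite muleA -ge0_muleDl ?lee_fin ?divr_ge0 ?mulr_ge0 ?invr_ge0 ?(ltW c0)//; last first.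
  by rewrite mulr_ge0 ?(ltW c0).
rewrite -EFinM -EFinD lee_wpmul2r// lee_fin.
suff -> : (c / 2 + (2 * c)^-1 * c ^+ 2 = c)%R by [].
by field; rewrite gt_eqF.
Qed.

End layer_cake.

(** * Kernels on a metric measure space *)

Section wolff_kernel.
Local Open Scope ereal_scope.
Context {R : realType} (phi : R -> R).
Hypothesis Hphi : class_Phi phi.
Notation leb := (@lebesgue_measure R).

(* If [phi] jumps at [0] this is finite at [(0, 0)], otherwise it is [+oo] there. *)
Definition wolff_kernel (u v : R) : \bar R :=
  \int[leb]_t (wolff_weight phi t * ((u < t)%R%:R * (v < t)%R%:R))%:E.

Lemma wolff_kernel_ge0 u v : 0 <= wolff_kernel u v.
Proof.
by apply: integral_ge0 => t _; rewrite lee_fin !mulr_ge0 ?ler0n ?wolff_weight_ge0.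
Qed.

Lemma measurable_ltn_indicator d (T : measurableType d) (f g : T -> R) :
  measurable_fun setT f -> measurable_fun setT g ->
  measurable_fun setT (fun x => (f x < g x)%R%:R : R).
Proof.
move=> mf mg; apply: (measurableT_comp (f := fun b : bool => b%:R : R)) => //.
exact: measurable_fun_ltr.
Qed.

Lemma measurable_wolff_kernel :
  measurable_fun setT (fun p : R * R => wolff_kernel p.1 p.2).
Proof.
apply: (measurable_fun_fubini_tonelli_F (m2 := leb) (fun p : (R * R) * R =>
   (wolff_weight phi p.2 * ((p.1.1 < p.2)%R%:R * (p.1.2 < p.2)%R%:R))%:E)).
  apply/measurable_EFinP; apply: measurable_funM.
    exact: measurableT_comp (measurable_wolff_weight Hphi) _.
  by apply: measurable_funM; apply: measurable_ltn_indicator => //; exact: measurableT_comp.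
by move=> p; rewrite lee_fin !mulr_ge0 ?ler0n ?wolff_weight_ge0.
Qed.

Lemma wolff_kernelE u v : (0 < Num.max u v)%R ->
  wolff_kernel u v = (2^-1 * (phi (Num.max u v))^-1 ^+ 2)%:E.
Proof.
move=> uv0; rewrite -integral_wolff_weight// [RHS]integral_mkcond.
apply: eq_integral => t _; rewrite patchE mem_setE in_itv/= andbT gt_max.
by case: (u < t)%R; case: (v < t)%R; rewrite ?(mulr0, mul0r, mulr1, mul1r).
Qed.

Context {d : measure_display} {T : measurableType d}.
Variables (nu : {finite_measure set T -> \bar R}) (D : T -> T -> R).
Hypothesis mD : measurable_fun setT (fun p : T * T => D p.1 p.2).

Definition tri_wolff x y z := wolff_kernel (D x y) (D x z).

(** The square of the measure of a ball is a double integral over [(y, z)], and Tonelli's theorem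
    moves the integral over the radius inside. *)
Lemma wolff_potentialE x :
  \int[leb]_(t in `]0%R, +oo[)
     ((nu [set y | (D x y < t)%R] * ((phi t)^-1)%:E) ^+ 2 * (derive1 phi t / phi t)%:E)
  = \int[nu]_y \int[nu]_z tri_wolff x y z.
Proof.
have mDx : measurable_fun setT (D x) by exact: measurableT_comp mD (pair1_measurable x).
have mB t : measurable [set y | (D x y < t)%R].
  have h : measurable_fun setT (fun y => (D x y < t)%R) by exact: measurable_fun_ltr.
  by have := h measurableT [set true] I; rewrite setTI.
have nuE t : \int[nu]_y (((D x y < t)%R%:R : R)%:E) = nu [set y | (D x y < t)%R].
  rewrite -[X in nu X]setIT -integral_indic//; apply: eq_integral => y _.
  by rewrite indicE mem_setE.
have mk : measurable_fun setT (fun p : T * R => (D x p.1 < p.2)%R%:R : R).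
  by apply: measurable_ltn_indicator => //; exact: measurableT_comp mDx _.
rewrite (@integral_layers _ _ _ nu (wolff_weight phi) (fun y t => (D x y < t)%R%:R)
  (fun y t => (D x y < t)%R%:R))//; last 2 first.
- exact: measurable_wolff_weight.
- exact: wolff_weight_ge0.
rewrite integral_mkcond; apply: eq_integral => t _.
rewrite patchE mem_setE in_itv/= andbT nuE /wolff_weight; case: ifPn => t0; last by rewrite mul0e.
have /fineK <- : nu [set y | (D x y < t)%R] \is a fin_num by exact: fin_num_measure.
rewrite -!EFinM; congr (_%:E).
by ring.
Qed.

End wolff_kernel.

(** * Bounds for the truncated triple integrals *)

Section metric_kernels.
Local Open Scope ereal_scope.
Context {R : realType} (phi : R -> R).
Hypothesis Hphi : class_Phi phi.
Variable L : R.
Hypothesis L1 : (1 < L)%R.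
Hypothesis dbl : (forall t, 0 <= t -> phi (2 * t) <= L * phi t)%R.
Context {d : measure_display} {T : measurableType d}.
Variables (nu : {finite_measure set T -> \bar R}) (D : T -> T -> R).
Hypothesis mD : measurable_fun setT (fun p : T * T => D p.1 p.2).
Hypothesis D0 : (forall x y, 0 <= D x y)%R.
Hypothesis DC : forall x y, D x y = D y x.
Hypothesis Dtri : (forall x y z, D x z <= D x y + D y z)%R.

Lemma measurable_dist_comp (f g : T * T * T -> T) :
  measurable_fun setT f -> measurable_fun setT g ->
  measurable_fun setT (fun w => D (f w) (g w)).
Proof.
move=> mf mg; have h : measurable_fun setT (fun w => (f w, g w)) by exact: measurable_fun_pair.
exact: (measurableT_comp mD h).
Qed.

Let m1 : measurable_fun setT (fun w : T * T * T => w.1.1).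
Proof. exact: measurableT_comp. Qed.
Let m2 : measurable_fun setT (fun w : T * T * T => w.1.2).
Proof. exact: measurableT_comp. Qed.
Let m3 : measurable_fun setT (fun w : T * T * T => w.2).
Proof. exact: measurable_snd. Qed.

Let mxy := measurable_dist_comp m1 m2.
Let mxz := measurable_dist_comp m1 m3.
Let myz := measurable_dist_comp m2 m3.

Section truncated.
Variable eps : R.
Hypothesis eps0 : (0 < eps)%R.

Lemma measurable_trunc_inv : measurable_fun setT (trunc_inv phi eps).
Proof.
apply: measurable_truncation => t et; have t0 := lt_trans eps0 et.
apply: continuousV; first by rewrite gt_eqF// (phi_gt0 Hphi).
exact: (phi_continuous Hphi).
Qed.

(** One truncated factor per side: this gives measurability, and later matches the product of two
    coordinate kernels. *)
Lemma angle_kernelE a b c : angle_kernel phi eps a b c =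
  ((b ^+ 2 + c ^+ 2 - a ^+ 2) / 2 *
  ((if eps < b then (b * phi b)^-1 else 0) * (if eps < c then (c * phi c)^-1 else 0)))%R.
Proof.
rewrite /angle_kernel; case: ifP => [/andP[-> ->]|].
  by rewrite !invfM; ring.
by case: ifP => //=; case: ifP => //=; rewrite ?(mul0r, mulr0).
Qed.

Lemma measurable_trunc_inv_mul :
  measurable_fun setT (fun t => if (eps < t)%R then (t * phi t)^-1%R else 0%R).
Proof.
apply: measurable_truncation => t et; have t0 := lt_trans eps0 et.
apply: continuousV; first by rewrite mulf_neq0 ?gt_eqF ?(phi_gt0 Hphi).
by apply: continuousM; [exact: cvg_id|exact: (phi_continuous Hphi)].
Qed.

Definition tri_angle x y z : R := angle_kernel phi eps (D y z) (D x y) (D x z).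

Lemma measurable_tri_angle :
  measurable_fun setT (fun w : T * T * T => tri_angle w.1.1 w.1.2 w.2).
Proof.
rewrite /tri_angle; under [X in measurable_fun _ X]eq_fun do rewrite angle_kernelE.
apply: measurable_funM.
  apply: measurable_funM => //; apply: measurable_funB; last exact: measurable_funX.
  by apply: measurable_funD; exact: measurable_funX.
by apply: measurable_funM; apply: (measurableT_comp measurable_trunc_inv_mul).
Qed.

Definition kernel_bound : R := ((phi eps)^-1 ^+ 2)%R.

Lemma tri_angle_bound x y z : (`|tri_angle x y z| <= kernel_bound)%R.
Proof.
apply: (angle_kernel_bound Hphi eps0) => //.
- by have := Dtri x z y; rewrite (DC z y); lra.
- by have := Dtri x y z; lra.
- by have := Dtri y x z; rewrite (DC y x); lra.
Qed.

(* The shift makes the kernel nonnegative, so that Tonelli's theorem applies to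
   the signed kernel; it is a finite constant that cancels in the end. *)
Definition tri_shifted x y z : \bar R := (tri_angle x y z + kernel_bound)%:E.

Lemma tri_shifted_ge0 x y z : 0 <= tri_shifted x y z.
Proof. by rewrite lee_fin; have := tri_angle_bound x y z; rewrite ler_norml => /andP[]; lra. Qed.

Lemma mfun3_tri_shifted : mfun3 tri_shifted.
Proof.
by apply/measurable_EFinP; apply: measurable_funD => //; exact: measurable_tri_angle.
Qed.

Lemma tri_shifted_rotations :
  tri nu (fun x y z => (sym_kernel phi eps (D y z) (D x y) (D x z) + 3 * kernel_bound)%:E)
  = tri nu tri_shifted + tri nu tri_shifted + tri nu tri_shifted.
Proof.
rewrite -(tri_rotations nu mfun3_tri_shifted tri_shifted_ge0).
apply: eq_tri => x y z; rewrite /tri_shifted -!EFinD; congr (_%:E).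
rewrite /sym_kernel /tri_angle (DC y x) (DC z x) (DC z y).
rewrite (angle_kernelC _ _ (D x z) (D y z)).
by ring.
Qed.

Lemma tri_cst_fin c : tri nu (fun _ _ _ => c%:E) \is a fin_num.
Proof.
rewrite /tri; under eq_integral do under eq_integral do rewrite integral_cst//.
under eq_integral do rewrite integral_cst//.
by rewrite integral_cst// !fin_numM ?fin_num_measure.
Qed.

Definition tri_hardy i x y z : \bar R := (hardy_term phi eps L i (D x y) (D x z))%:E.

Lemma tri_hardy_ge0 i x y z : 0 <= tri_hardy i x y z.
Proof. by rewrite lee_fin; exact: hardy_term_ge0. Qed.

Lemma mfun3_tri_hardy i : mfun3 (tri_hardy i).
Proof.
apply/measurable_EFinP; do 2 (apply: measurable_funM => //).
have mq (f : T * T * T -> R) : measurable_fun setT f ->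
    measurable_fun setT (fun w => trunc_inv phi eps (f w) ^+ 2)%R.
  by move=> mf; apply: measurable_funX; exact: (measurableT_comp measurable_trunc_inv).
apply: measurable_minr; first exact: mq mxy.
by apply: measurable_funM => //; exact: mq mxz.
Qed.

(** For fixed [x], [integral_min_scale] with constant [L^i] costs exactly the weight [L^-i] of
    [hardy_term]; only [2^-i] remains. *)
Lemma tri_hardy_le i : tri nu (tri_hardy i) <= (2^-1 ^+ i)%:E * tri nu (tri_hardy 0).
Proof.
have L0 := lt_trans ltr01 L1.
have h0 : (0 <= 2^-1 ^+ i :> R)%R by rewrite exprn_ge0.
have c0 : (0 < L ^+ i)%R by rewrite exprn_gt0.
pose c : R := (2^-1 ^+ i * L^-1 ^+ i)%R.
have cge0 : (0 <= c)%R by rewrite mulr_ge0// exprn_ge0// invr_ge0 ltW.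
pose q x y : R := (trunc_inv phi eps (D x y) ^+ 2)%R.
have q0 x y : (0 <= q x y)%R by exact: sqr_ge0.
have mDx x : measurable_fun setT (D x) by exact: measurableT_comp mD (pair1_measurable x).
have mq x : measurable_fun setT (q x).
  by apply: measurable_funX; exact: (measurableT_comp measurable_trunc_inv).
have H0 x y z : tri_hardy 0 x y z = (Num.min (q x y) (q x z))%:E.
  by rewrite /tri_hardy /hardy_term !expr0 expr1n !mul1r.
have Hi x y z : tri_hardy i x y z = c%:E * (Num.min (q x y) ((L ^+ i) ^+ 2 * q x z))%:E.
  by rewrite /tri_hardy /hardy_term /c -EFinM mulrA.
have mm x : measurable_fun setT (fun p : T * T => (Num.min (q x p.1) ((L ^+ i) ^+ 2 * q x p.2))%:E).
  apply/measurable_EFinP; apply: measurable_minr; first exact: measurableT_comp (mq x) _.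
  by apply: measurable_funM => //; exact: measurableT_comp (mq x) _.
have mm0 x y z : 0 <= (Num.min (q x y) ((L ^+ i) ^+ 2 * q x z))%:E.
  by rewrite lee_fin le_min q0 mulr_ge0// sqr_ge0.
have eZ := triZ nu (mfun3_tri_hardy 0) h0 (tri_hardy_ge0 0).
rewrite -eZ {eZ}.
have mZ : mfun3 (fun x y z => (2^-1 ^+ i)%:E * tri_hardy 0 x y z).
  by apply: measurable_funeM; exact: mfun3_tri_hardy.
have Z0 x y z : 0 <= (2^-1 ^+ i)%:E * tri_hardy 0 x y z by rewrite mule_ge0// tri_hardy_ge0.
apply: ge0_le_integral => //.
- by move=> x _; do 2 (apply: integral_ge0 => ? _); exact: tri_hardy_ge0.
- by apply: measurable_int2; [exact: mfun3_tri_hardy|exact: tri_hardy_ge0].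
- exact: measurable_int2.
move=> x _.
under eq_integral do under eq_integral do rewrite Hi.
under [leRHS]eq_integral do under eq_integral do rewrite H0.
have ZE (g : T -> T -> R) (e : R) : (0 <= e)%R ->
    measurable_fun setT (fun p : T * T => (g p.1 p.2)%:E) -> (forall y z, 0 <= (g y z)%:E) ->
    \int[nu]_y \int[nu]_z (e%:E * (g y z)%:E) = e%:E * \int[nu]_y \int[nu]_z (g y z)%:E.
  move=> e0 mg g0; rewrite -ge0_integralZl//.
  - apply: eq_integral => y _; rewrite -ge0_integralZl//.
    exact: measurableT_comp mg (pair1_measurable y).
  - exact: (measurable_fun_fubini_tonelli_F (fun p : T * T => (g p.1 p.2)%:E)).
  - by move=> y _; exact: integral_ge0.
rewrite (ZE (fun y z => Num.min (q x y) ((L ^+ i) ^+ 2 * q x z)%R) c cge0 (mm x) (mm0 x)).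
rewrite (ZE (fun y z => Num.min (q x y) (q x z)) _ h0)//; last 2 first.
- apply/measurable_EFinP; apply: measurable_minr; exact: measurableT_comp (mq x) _.
- by move=> y z; rewrite lee_fin le_min !q0.
apply: (le_trans (lee_wpmul2l _ (integral_min_scale nu c0 (mq x) (q0 x)))) => //.
rewrite muleA -EFinM; apply: lee_wpmul2r.
  by do 2 (apply: integral_ge0 => ? _); rewrite lee_fin le_min !q0.
by rewrite lee_fin /c -mulrA -exprMn mulVf ?expr1n ?mulr1// gt_eqF.
Qed.

(** The index given by [sym_kernel_le] depends on the triangle; summing over all indices dominates
    it without any measurable choice. *)
Definition tri_hardy_series x y z : \bar R := \sum_(0 <= i <oo) tri_hardy i x y z.

Lemma tri_hardy_series_ge0 x y z : 0 <= tri_hardy_series x y z.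
Proof. by apply: nneseries_ge0 => i _ _; exact: tri_hardy_ge0. Qed.

Lemma mfun3_tri_hardy_series : mfun3 tri_hardy_series.
Proof.
apply: ge0_emeasurable_sum => [i w _ _|i _]; first exact: tri_hardy_ge0.
exact: mfun3_tri_hardy.
Qed.

Lemma tri_hardy0_le x y z : tri_hardy 0 x y z <= 2%:E * tri_wolff phi D x y z.
Proof.
rewrite /tri_hardy /hardy_term !expr0 expr1n !mul1r.
apply: (@le_trans _ _ ((trunc_inv phi eps (Num.max (D x y) (D x z)) ^+ 2)%:E)).
  by rewrite lee_fin ge_min; have [_|_] := leP (D x y) (D x z); rewrite lexx ?orbT.
rewrite /trunc_inv; case: ifPn => em; last first.
  by rewrite expr0n/= mule_ge0// wolff_kernel_ge0.
rewrite /tri_wolff wolff_kernelE//; last exact: lt_trans em.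
by rewrite -EFinM mulrA divff// mul1r.
Qed.

Lemma mfun3_tri_wolff : mfun3 (tri_wolff phi D).
Proof.
have h : measurable_fun setT (fun w : T * T * T => (D w.1.1 w.1.2, D w.1.1 w.2)).
  exact: measurable_fun_pair.
exact: (measurableT_comp (measurable_wolff_kernel Hphi) h).
Qed.

Lemma tri_wolff_ge0 x y z : 0 <= tri_wolff phi D x y z.
Proof. exact: wolff_kernel_ge0. Qed.

Lemma nneseries_half (c : \bar R) : 0 <= c ->
  \sum_(0 <= i <oo) ((2^-1 ^+ i)%:E * c) = 2%:E * c.
Proof.
have h0 i : (0 < 2^-1 ^+ i :> R)%R by rewrite exprn_gt0.
case: c => [c| |] c0 //.
  have := @cvg_geometric_eseries_half R (2 * c) 0; rewrite expr0 divr1 => h.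
  rewrite -EFinM -(cvg_lim _ h)//; congr (limn _); apply/funext => n.
  apply: eq_bigr => i _; rewrite -EFinM; congr (_%:E).
  by rewrite addn1 natrX exprS exprVn invfM; field; rewrite expf_neq0.
rewrite mulry gtr0_sg// mul1e; apply/eqP; rewrite -leye_eq.
apply: le_trans (nneseries_lim_ge 1 _) => [|i _ _]; last by rewrite mule_ge0// lee_fin ltW.
by rewrite big_nat1 expr0 mul1e.
Qed.

Lemma tri_hardy_series_le :
  tri nu tri_hardy_series <= 4%:E * tri nu (tri_wolff phi D).
Proof.
have H0 : 0 <= tri nu (tri_hardy 0).
  by do 3 (apply: integral_ge0 => ? _); exact: tri_hardy_ge0.
have e : tri nu tri_hardy_series = _ := tri_nneseries nu mfun3_tri_hardy tri_hardy_ge0.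
rewrite {}e.
apply: (@le_trans _ _ (\sum_(0 <= i <oo) ((2^-1 ^+ i)%:E * tri nu (tri_hardy 0)))).
  apply: lee_nneseries => [i _ _|i _]; last exact: tri_hardy_le.
  by do 3 (apply: integral_ge0 => ? _); exact: tri_hardy_ge0.
rewrite (nneseries_half H0).
(* One factor 2 is the sum of the geometric series, the other compensates the [1/2] in the Wolff
   kernel. *)
have -> : 4%:E = 2%:E * 2%:E :> \bar R by rewrite -EFinM; congr (_%:E); ring.
rewrite -muleA lee_wpmul2l//.
have eZ := triZ nu mfun3_tri_wolff (ler0n R 2) tri_wolff_ge0.
rewrite -eZ; apply: (le_tri _ (mfun3_tri_hardy 0)).
- by apply: measurable_funeM; exact: mfun3_tri_wolff.
- exact: tri_hardy_ge0.
- exact: tri_hardy0_le.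
Qed.

Lemma mfun3_sym_shifted :
  mfun3 (fun x y z => (sym_kernel phi eps (D y z) (D x y) (D x z) + 3 * kernel_bound)%:E).
Proof.
have mS := mfun3_tri_shifted.
have := mfun3D (mfun3D mS (mfun3_rot1 mS)) (mfun3_rot2 mS).
rewrite /mfun3; congr (measurable_fun _ _); apply/funext => w.
rewrite /uncurry3 /tri_shifted -!EFinD; congr (_%:E).
rewrite /sym_kernel /tri_angle (DC w.1.2 w.1.1) (DC w.2 w.1.1) (DC w.2 w.1.2).
rewrite (angle_kernelC _ _ (D w.1.1 w.2) (D w.1.2 w.2)).
by ring.
Qed.

Lemma sym_shifted_ge0 x y z :
  0 <= (sym_kernel phi eps (D y z) (D x y) (D x z) + 3 * kernel_bound)%:E.
Proof.
have := adde_ge0 (adde_ge0 (tri_shifted_ge0 x y z) (tri_shifted_ge0 y z x)) (tri_shifted_ge0 z x y).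
rewrite /tri_shifted -!EFinD !lee_fin /sym_kernel /tri_angle (DC y x) (DC z x) (DC z y).
rewrite (angle_kernelC _ _ (D x z) (D y z)); lra.
Qed.

(** An ordered pair of sides amounts to their common vertex and an order of the other two vertices:
    the six terms of [pair_sum] become the six permutations. *)
Definition hardy_perms x y z : \bar R :=
  (tri_hardy_series x y z + tri_hardy_series y z x + tri_hardy_series z x y) +
  (tri_hardy_series x z y + tri_hardy_series y x z + tri_hardy_series z y x).

Lemma sym_kernel_le_series x y z :
  (sym_kernel phi eps (D y z) (D x y) (D x z))%:E <=
  (2 * upper_const L)%:E * hardy_perms x y z.
Proof.
have L0 := lt_trans ltr01 L1.
have C0 : (0 <= upper_const L)%R.
  by rewrite /upper_const addr_ge0 ?(ltW L0)// !mulr_ge0 ?addr_ge0 ?mulr_ge0 ?addr_ge0 ?(ltW L0).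
have t1 : (D x z <= D y z + D x y)%R by have := Dtri x y z; lra.
have t2 : (D x y <= D y z + D x z)%R by have := Dtri x z y; rewrite (DC z y); lra.
have t3 : (D y z <= D x y + D x z)%R by have := Dtri y x z; rewrite (DC y x); lra.
have [i] := sym_kernel_le Hphi eps0 L1 dbl (D0 y z) (D0 x y) (D0 x z) t1 t2 t3.
rewrite -lee_fin => h; apply: (le_trans h).
have hS u v w j : tri_hardy j u v w <= tri_hardy_series u v w.
  apply: le_trans (nneseries_lim_ge j.+1 _) => [|k _ _]; last exact: tri_hardy_ge0.
  rewrite big_mkord big_ord_recr/= leeDr// sume_ge0// => k _; exact: tri_hardy_ge0.
(* The indices 0 and [i] may coincide, so each term is bounded by the whole series; hence the factor
   2. *)
have hS2 u v w : (hardy_term phi eps L 0 (D u v) (D u w) + hardy_term phi eps L i (D u v) (D u w))%:E <=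
    2%:E * tri_hardy_series u v w.
  have -> : 2%:E * tri_hardy_series u v w = tri_hardy_series u v w + tri_hardy_series u v w.
    by rewrite -mule2n mule_natl.
  by rewrite EFinD; apply: leeD; exact: hS.
have -> : (2 * upper_const L)%:E * hardy_perms x y z = (upper_const L)%:E * (2%:E * hardy_perms x y z).
  by rewrite muleA -EFinM mulrC.
rewrite EFinM lee_wpmul2l ?lee_fin//.
set f := (fun u v : R => _); set a := D y z; set b := D x y; set c := D x z.
have -> : pair_sum f a b c = (f b c + f a b + f c a + (f c b + f b a + f a c))%R.
  by rewrite /pair_sum; ring.
have S0 := tri_hardy_series_ge0.
rewrite /hardy_perms !ge0_muleDr ?adde_ge0// !EFinD.
have := hS2 y z x; have := hS2 y x z; have := hS2 z y x; have := hS2 z x y.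
have := hS2 x y z; have := hS2 x z y.
rewrite -/f (DC y x) (DC z x) (DC z y) -/a -/b -/c => h1 h2 h3 h4 h5 h6.
by do !apply: leeD.
Qed.

Lemma mfun3_hardy_perms : mfun3 hardy_perms.
Proof.
have mS := mfun3_tri_hardy_series; have mS' := mfun3_swap23 mS.
apply: (mfun3D (mfun3D (mfun3D mS (mfun3_rot1 mS)) (mfun3_rot2 mS))).
exact: (mfun3D (mfun3D mS' (mfun3_rot1 mS')) (mfun3_rot2 mS')).
Qed.

Lemma hardy_perms_ge0 x y z : 0 <= hardy_perms x y z.
Proof. by have S0 := tri_hardy_series_ge0; rewrite /hardy_perms !adde_ge0. Qed.

Let bound3 := tri nu (fun _ _ _ => kernel_bound%:E).

Lemma kernel_bound_ge0 : (0 <= kernel_bound)%R.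
Proof. exact: sqr_ge0. Qed.

Lemma tri_cstM3 : tri nu (fun _ _ _ => (3 * kernel_bound)%:E) = 3%:E * bound3.
Proof.
have M0 := kernel_bound_ge0.
have m : mfun3 (fun _ _ _ : T => kernel_bound%:E) by exact: measurable_cst.
exact: (triZ nu m (ler0n R 3) (fun _ _ _ => M0)).
Qed.

Lemma upper_const_gt0 : (0 < upper_const L)%R.
Proof.
have L0 := lt_trans ltr01 L1.
by rewrite /upper_const addr_gt0// !mulr_gt0 ?addr_gt0 ?mulr_gt0 ?addr_gt0.
Qed.

(** With [C = upper_const L] and [W] the Wolff energy, the three rotations give [3 I] on the left,
    and the six permutations, each at most [4 W], give [2 C * 6 * 4 W] on the right. The shift is
    finite and cancels. *)
Lemma tri_shifted_upper (I : \bar R) :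
  I + bound3 = tri nu tri_shifted ->
  I <= (16 * upper_const L)%:E * tri nu (tri_wolff phi D).
Proof.
move=> Ie; have C0 := upper_const_gt0; have M0 := kernel_bound_ge0.
set W := tri nu (tri_wolff phi D).
have W0 : 0 <= W by do 3 (apply: integral_ge0 => ? _); exact: tri_wolff_ge0.
have mc (c : R) : mfun3 (fun _ _ _ : T => c%:E) by exact: measurable_cst.
have mP := mfun3_hardy_perms; have P0 := hardy_perms_ge0.
have C20 : (0 <= 2 * upper_const L)%R by rewrite mulr_ge0// ltW.
have mCP : mfun3 (fun x y z => (2 * upper_const L)%:E * hardy_perms x y z).
  exact: measurable_funeM.
have CP0 x y z : 0 <= (2 * upper_const L)%:E * hardy_perms x y z by rewrite mule_ge0.
have M30 : (0 <= 3 * kernel_bound)%R by rewrite mulr_ge0.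
have : tri nu tri_shifted + tri nu tri_shifted + tri nu tri_shifted <=
    (2 * upper_const L)%:E * tri nu hardy_perms + 3%:E * bound3.
  rewrite -tri_shifted_rotations -tri_cstM3 -(triZ nu mP C20 P0).
  rewrite -(triD nu mCP (mc _) CP0 (fun _ _ _ => M30)).
  apply: (le_tri nu mfun3_sym_shifted (mfun3D mCP (mc _)) sym_shifted_ge0).
  by move=> x y z; rewrite EFinD leeD2r// sym_kernel_le_series.
have -> : tri nu hardy_perms = _ :=
  tri_permutations nu mfun3_tri_hardy_series tri_hardy_series_ge0.
have := tri_hardy_series_le; rewrite -/W.
have : 0 <= tri nu tri_hardy_series.
  by do 3 (apply: integral_ge0 => ? _); exact: tri_hardy_series_ge0.
rewrite -Ie; have := tri_cst_fin kernel_bound; rewrite -/bound3.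
move: (tri nu tri_hardy_series) => s; move: bound3 => b.
move: W W0 => [W| |]// W0; last first.
  by move=> *; rewrite gt0_muley ?leey// lte_fin mulr_gt0.
case: b => [b| |]// _; case: s => [s| |]//; case: (I) => [i| |]//; last by move=> *; rewrite leNye.
rewrite -!EFinM -!EFinD !lee_fin => s0 sW.
have : (upper_const L * s <= upper_const L * (4 * W))%R by rewrite ler_pM2l.
by lra.
Qed.

Lemma tri_shifted_lower (I : \bar R) (c : R) (K : T -> T -> T -> R) :
  I + bound3 = tri nu tri_shifted -> (0 <= c)%R ->
  mfun3 (fun x y z => (K x y z)%:E) -> (forall x y z, 0 <= K x y z)%R ->
  (forall x y z, c * K x y z <= sym_kernel phi eps (D y z) (D x y) (D x z))%R ->
  (c / 3)%:E * tri nu (fun x y z => (K x y z)%:E) <= I.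
Proof.
move=> Ie c0 mK K0 KS; have M0 := kernel_bound_ge0.
set k := tri nu _.
have k0 : 0 <= k by do 3 (apply: integral_ge0 => ? _); rewrite lee_fin.
have mc (e : R) : mfun3 (fun _ _ _ : T => e%:E) by exact: measurable_cst.
have mCK : mfun3 (fun x y z => c%:E * (K x y z)%:E) by exact: measurable_funeM.
have CK0 x y z : 0 <= c%:E * (K x y z)%:E by rewrite mule_ge0// lee_fin.
have K0' x y z : 0 <= (K x y z)%:E by rewrite lee_fin.
have M30 : (0 <= 3 * kernel_bound)%R by rewrite mulr_ge0.
have : c%:E * k + 3%:E * bound3 <=
    tri nu tri_shifted + tri nu tri_shifted + tri nu tri_shifted.
  rewrite -tri_shifted_rotations -tri_cstM3 -(triZ nu mK c0 K0').
  rewrite -(triD nu mCK (mc _) CK0 (fun _ _ _ => M30)).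
  apply: (le_tri nu (mfun3D mCK (mc _)) mfun3_sym_shifted) => x y z.
    by rewrite adde_ge0// lee_fin.
  by rewrite -EFinM -EFinD lee_fin lerD2r.
rewrite -Ie; have := tri_cst_fin kernel_bound; rewrite -/bound3.
move: bound3 => [b| |]// _.
(* For [c = 0] the left-hand side is 0 even if [k] is infinite, whereas for [c > 0] an infinite [k]
   forces [I] to be infinite. *)
have [->|cn0] := eqVneq c 0%R.
  rewrite mul0r !mul0e add0e; case: (I) => [i| |] h; [|by rewrite leey|by []].
  by move: h; rewrite -!EFinM -!EFinD !lee_fin; lra.
have cp : (0 < c)%R by rewrite lt_neqAle eq_sym cn0.
move: k k0 => [k| |]// k0.
  case: (I) => [i| |] h; [|by rewrite leey|by []].
  by move: h; rewrite -!EFinM -!EFinD !lee_fin; lra.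
rewrite !gt0_muley ?lte_fin ?divr_gt0//.
by case: (I).
Qed.

End truncated.
End metric_kernels.

(** * Almost everywhere comparison and monotone convergence of triple integrals *)

Section tri_limits.
Local Open Scope ereal_scope.
Context {d : measure_display} {T : measurableType d} {R : realType}.
Variable nu : {finite_measure set T -> \bar R}.

Lemma ae_le_tri (K K' : T -> T -> T -> \bar R) : mfun3 K -> mfun3 K' ->
  (forall x y z, 0 <= K x y z) -> (forall x y z, 0 <= K' x y z) ->
  (forall x, {ae nu, forall y, {ae nu, forall z, K x y z <= K' x y z}}) ->
  tri nu K <= tri nu K'.
Proof.
move=> mK mK' K0 K'0 h.
apply: ge0_le_integral => //; [|exact: measurable_int2..|].
  by move=> x _; apply: integral_ge0 => y _; exact: integral_ge0.
move=> x _; apply: ae_ge0_le_integral => //.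
- by move=> y _; exact: integral_ge0.
- exact: measurable_int1.
- by move=> y _; exact: integral_ge0.
- exact: measurable_int1.
apply: filterS (h x) => y hy _; apply: ae_ge0_le_integral => //.
- exact: mfun3_z.
- exact: mfun3_z.
- by apply: filterS hy.
Qed.

Lemma cvg_tri (K : nat -> T -> T -> T -> \bar R) (K' : T -> T -> T -> \bar R) :
  (forall n, mfun3 (K n)) -> (forall n x y z, 0 <= K n x y z) ->
  (forall x y z, {homo (fun n => K n x y z) : n m / (n <= m)%N >-> n <= m}) ->
  (forall x y z, K n x y z @[n --> \oo] --> K' x y z) ->
  tri nu (K n) @[n --> \oo] --> tri nu K'.
Proof.
move=> mK K0 ndK cK.
have c1 x y : \int[nu]_z K n x y z @[n --> \oo] --> \int[nu]_z K' x y z.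
  have -> : \int[nu]_z K' x y z = \int[nu]_z limn (fun n => K n x y z).
    by apply: eq_integral => z _; apply/esym/cvg_lim.
  by apply: cvg_monotone_convergence => // n; exact: mfun3_z.
have nd1 x y : {homo (fun n => \int[nu]_z K n x y z) : n m / (n <= m)%N >-> n <= m}.
  move=> n m nm; apply: ge0_le_integral => //; [exact: mfun3_z..|].
  by move=> z _; exact: ndK.
have c2 x : \int[nu]_y \int[nu]_z K n x y z @[n --> \oo] --> \int[nu]_y \int[nu]_z K' x y z.
  have -> : \int[nu]_y \int[nu]_z K' x y z = \int[nu]_y limn (fun n => \int[nu]_z K n x y z).
    by apply: eq_integral => y _; apply/esym/cvg_lim; [|exact: c1].
  apply: cvg_monotone_convergence => //.
    by move=> n; exact: measurable_int1.
  by move=> n y _; exact: integral_ge0.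
have nd2 x : {homo (fun n => \int[nu]_y \int[nu]_z K n x y z) : n m / (n <= m)%N >-> n <= m}.
  move=> n m nm; apply: ge0_le_integral => //; [|exact: measurable_int1..|].
    by move=> y _; exact: integral_ge0.
  by move=> y _; exact: nd1 nm.
rewrite /tri.
have -> : \int[nu]_x \int[nu]_y \int[nu]_z K' x y z =
    \int[nu]_x limn (fun n => \int[nu]_y \int[nu]_z K n x y z).
  by apply: eq_integral => x _; apply/esym/cvg_lim; [|exact: c2].
apply: cvg_monotone_convergence => //.
- by move=> n; exact: measurable_int2.
- by move=> n x _; apply: integral_ge0 => y _; exact: integral_ge0.
Qed.

End tri_limits.

(** * Removing the truncation for a measure without atoms *)

Section no_atoms.
Local Open Scope ereal_scope.
Context {R : realType} (phi : R -> R).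
Hypothesis Hphi : class_Phi phi.
Variable L : R.
Hypothesis L1 : (1 < L)%R.
Hypothesis dbl : (forall t, 0 <= t -> phi (2 * t) <= L * phi t)%R.
Context {d : measure_display} {T : measurableType d}.
Variables (nu : {finite_measure set T -> \bar R}) (D : T -> T -> R).
Hypothesis mD : measurable_fun setT (fun p : T * T => D p.1 p.2).
Hypothesis D0 : (forall x y, 0 <= D x y)%R.
Hypothesis DC : forall x y, D x y = D y x.
Hypothesis Dtri : (forall x y z, D x z <= D x y + D y z)%R.
Hypothesis no_atom : forall x, nu [set y | (D x y <= 0)%R] = 0.

Definition tri_lower eps x y z : R := lower_kernel phi eps (D y z) (D x y) (D x z).

Lemma tri_lower_ge0 eps x y z : (0 <= tri_lower eps x y z)%R.
Proof. by rewrite /tri_lower /lower_kernel; case: ifP => // _; exact: sqr_ge0. Qed.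

Lemma mfun3_tri_lower eps : (0 <= eps)%R -> mfun3 (fun x y z => (tri_lower eps x y z)%:E).
Proof.
move=> eps0.
have mq : measurable_fun setT (fun t => if (eps < t)%R then (phi t)^-1%R else 0%R).
  apply: measurable_truncation => t et; have t0 := le_lt_trans eps0 et.
  apply: continuousV; first by rewrite gt_eqF// (phi_gt0 Hphi).
  exact: (phi_continuous Hphi).
apply/measurable_EFinP.
pose m (w : T * T * T) := Num.max (D w.1.2 w.2) (Num.max (D w.1.1 w.1.2) (D w.1.1 w.2)).
have m1 : measurable_fun setT (fun w : T * T * T => w.1.1) by exact: measurableT_comp.
have m2 : measurable_fun setT (fun w : T * T * T => w.1.2) by exact: measurableT_comp.
have m3 : measurable_fun setT (fun w : T * T * T => w.2) by exact: measurable_snd.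
have mxy := measurable_dist_comp mD m1 m2.
have mxz := measurable_dist_comp mD m1 m3.
have myz := measurable_dist_comp mD m2 m3.
have mm : measurable_fun setT m by apply: measurable_maxr => //; exact: measurable_maxr.
(* The inner truncation is invisible where the guard holds, and it replaces [phi] by a function
   measurable on the whole line. *)
have -> : (fun w : T * T * T => tri_lower eps w.1.1 w.1.2 w.2) = (fun w =>
    if [&& eps < D w.1.2 w.2, eps < D w.1.1 w.1.2 & eps < D w.1.1 w.2]%R then
      ((if (eps < m w)%R then (phi (m w))^-1 else 0) ^+ 2)%R else 0%R).
  apply/funext => w; rewrite /tri_lower /lower_kernel; case: ifP => // /and3P[h _ _].
  by rewrite /m lt_max h.
apply: measurable_fun_ifT => //; last first.
  by apply: measurable_funX; exact: (measurableT_comp mq mm).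
by apply: measurable_and; [|apply: measurable_and]; exact: measurable_fun_ltr.
Qed.

(** The Wolff kernel sees the two sides at [x], the lower kernel all three. The third side is at
    most twice the larger of those two, so doubling costs [L], squared; the [1/2] is that of the
    Wolff kernel. Degenerate triangles, where [tri_lower 0] vanishes, are negligible by
    [no_atom]. *)
Lemma tri_wolff_le_lower :
  tri nu (tri_wolff phi D) <= (L ^+ 2 / 2)%:E * tri nu (fun x y z => (tri_lower 0 x y z)%:E).
Proof.
have mW := mfun3_tri_wolff Hphi mD; have mK := mfun3_tri_lower (lexx 0%R).
have c0 : (0 <= L ^+ 2 / 2)%R by rewrite divr_ge0 ?sqr_ge0.
have K0 x y z : 0 <= (tri_lower 0 x y z)%:E by rewrite lee_fin tri_lower_ge0.
have e := triZ nu mK c0 K0; rewrite -e {e}.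
have mDx x : measurable_fun setT (D x) by exact: measurableT_comp mD (pair1_measurable x).
have ae_pos x : {ae nu, forall y, (0 < D x y)%R}.
  exists [set y | (D x y <= 0)%R]; split => //.
    have h : measurable_fun setT (fun y => (D x y <= 0)%R) by exact: measurable_fun_ler.
    by have := h measurableT [set true] I; rewrite setTI.
  by move=> y /= /negP; rewrite -leNgt.
apply: ae_le_tri => //.
- by apply: measurable_funeM.
- by move=> x y z; exact: wolff_kernel_ge0.
- by move=> x y z; rewrite mule_ge0.
move=> x; apply: filterS (ae_pos x) => y xy.
apply: filterS2 (ae_pos x) (ae_pos y) => z xz yz.
rewrite /tri_wolff wolff_kernelE//; last by rewrite lt_max xy.
rewrite -EFinM lee_fin /tri_lower /lower_kernel xy xz yz/=.
set b := D x y; set c := D x z; set a := D y z.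
have m0 : (0 < Num.max b c)%R by rewrite lt_max xy.
have am : (a <= 2 * Num.max b c)%R.
  have bm : (b <= Num.max b c)%R by rewrite le_max lexx.
  have cm : (c <= Num.max b c)%R by rewrite le_max lexx orbT.
  by have := Dtri y x z; rewrite (DC y x) -/a -/b -/c; lra.
set m := Num.max a _.
have mm : (m <= 2 * Num.max b c)%R by rewrite ge_max am/=; lra.
have mp : (0 < m)%R by rewrite lt_max m0 orbT.
have h : (phi m <= L * phi (Num.max b c))%R.
  by apply: (phi_le_dbl Hphi dbl) => //; exact: ltW.
have h2 : ((phi (Num.max b c))^-1 <= L * (phi m)^-1)%R.
  rewrite ler_pdivlMr ?(phi_gt0 Hphi)// mulrC ler_pdivrMr ?(phi_gt0 Hphi)//.
have h3 : ((phi (Num.max b c))^-1 ^+ 2 <= (L * (phi m)^-1) ^+ 2)%R.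
  rewrite ler_sqr// nnegrE; first exact/ltW/inv_phi_gt0.
  by rewrite mulr_ge0 ?(ltW (inv_phi_gt0 Hphi mp))// ltW// (lt_trans ltr01).
by move: h3; rewrite exprMn; lra.
Qed.

Lemma lower_kernel_nincr eps eps' a b c : (0 <= eps')%R -> (eps' <= eps)%R ->
  (lower_kernel phi eps a b c <= lower_kernel phi eps' a b c)%R.
Proof.
move=> e0 ee; rewrite /lower_kernel; case: ifP => [/and3P[ea eb ec]|_].
  by rewrite !(le_lt_trans ee).
by case: ifP => // _; exact: sqr_ge0.
Qed.

Lemma cvg_tri_lower :
  tri nu (fun x y z => (tri_lower n.+1%:R^-1 x y z)%:E) @[n --> \oo] -->
  tri nu (fun x y z => (tri_lower 0 x y z)%:E).
Proof.
apply: cvg_tri.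
- by move=> n; apply: mfun3_tri_lower; rewrite invr_ge0.
- by move=> n x y z; rewrite lee_fin tri_lower_ge0.
- move=> x y z n m nm; rewrite lee_fin; apply: lower_kernel_nincr.
    by rewrite invr_ge0.
  by rewrite lef_pV2 ?posrE ?ltr0n// ler_nat.
move=> x y z; apply: cvg_near_cst.
(* Each guard of [lower_kernel] is eventually constant in [n], so the pointwise limit is attained at
   a finite stage. *)
have ev t : \forall n \near \oo, (n.+1%:R^-1 < t :> R)%R = (0 < t)%R.
  have [t0|t0] := ltP 0%R t; last first.
    by near=> n; apply/negbTE; rewrite -leNgt (le_trans t0)// invr_ge0.
  by apply: filterS (near_infty_natSinv_lt (PosNum t0)) => n /= ->.
near=> n; rewrite /tri_lower /lower_kernel.
have -> : (n.+1%:R^-1 < D y z)%R = (0 < D y z)%R by near: n; exact: ev.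
have -> : (n.+1%:R^-1 < D x y)%R = (0 < D x y)%R by near: n; exact: ev.
have -> : (n.+1%:R^-1 < D x z)%R = (0 < D x z)%R by near: n; exact: ev.
by [].
Unshelve. all: by end_near. Qed.

End no_atoms.

(** * Euclidean space *)

Section enorm.
Context {R : realType} {d : nat}.
Implicit Types u v x y z : 'rV[R]_d.

Definition dotr u v : R := \sum_(i < d) u ord0 i * v ord0 i.

Lemma enorm_ge0 v : 0 <= enorm v.
Proof. exact: sqrtr_ge0. Qed.

Lemma enorm_sqr v : enorm v ^+ 2 = \sum_(i < d) v ord0 i ^+ 2.
Proof. by rewrite sqr_sqrtr// sumr_ge0// => i _; exact: sqr_ge0. Qed.

Lemma enormBC x y : enorm (y - x) = enorm (x - y).
Proof.
by congr Num.sqrt; apply: eq_bigr => i _; rewrite !mxE -sqrrN opprB.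
Qed.

Lemma enormD_sqr u v : enorm (u + v) ^+ 2 = enorm u ^+ 2 + 2 * dotr u v + enorm v ^+ 2.
Proof.
rewrite !enorm_sqr /dotr mulr_sumr -!big_split/=; apply: eq_bigr => i _.
by rewrite !mxE; ring.
Qed.

Lemma dotr_le u v : dotr u v <= enorm u * enorm v.
Proof.
have [v0|v0] := eqVneq (enorm v) 0.
  rewrite v0 mulr0 /dotr big1// => i _.
  have := enorm_sqr v; rewrite v0 expr0n/= => /esym/eqP.
  rewrite psumr_eq0; last by move=> j _; exact: sqr_ge0.
  move=> /allP/(_ i); rewrite mem_index_enum => /(_ isT)/=.
  by rewrite sqrf_eq0 => /eqP ->; rewrite mulr0.
have v1 : 0 < enorm v by rewrite lt_neqAle eq_sym v0 enorm_ge0.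
suff h : dotr u v ^+ 2 <= (enorm u * enorm v) ^+ 2.
  apply: le_trans (ler_norm _) _.
  by rewrite -ler_sqr ?nnegrE ?mulr_ge0 ?enorm_ge0// real_normK ?num_real.
(* The squared norm of [|v|^2] times the component of [u] orthogonal to [v]. *)
have : 0 <= \sum_(i < d) (enorm v ^+ 2 * u ord0 i - dotr u v * v ord0 i) ^+ 2.
  by rewrite sumr_ge0// => i _; exact: sqr_ge0.
have -> : \sum_(i < d) (enorm v ^+ 2 * u ord0 i - dotr u v * v ord0 i) ^+ 2 =
    enorm v ^+ 2 * ((enorm u * enorm v) ^+ 2 - dotr u v ^+ 2).
  have key a b : \sum_(i < d) (a * u ord0 i - b * v ord0 i) ^+ 2 =
      a ^+ 2 * (\sum_(i < d) u ord0 i ^+ 2) - 2 * a * b * dotr u v +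
      b ^+ 2 * (\sum_(i < d) v ord0 i ^+ 2).
    rewrite /dotr !mulr_sumr -sumrN -!big_split/=.
    by apply: eq_bigr => i _; ring.
  by rewrite key -!enorm_sqr; ring.
by rewrite pmulr_rge0 ?exprn_gt0// subr_ge0.
Qed.

Lemma enorm_triangle x y z : enorm (z - x) <= enorm (y - x) + enorm (z - y).
Proof.
have -> : z - x = (y - x) + (z - y) by rewrite [RHS]addrC addrA subrK.
rewrite -ler_sqr ?nnegrE ?addr_ge0 ?enorm_ge0//.
rewrite enormD_sqr; have := dotr_le (y - x) (z - y); nra.
Qed.

(** The law of cosines, which turns the scalar product of two vector kernels into [angle_kernel]. *)
Lemma dotrBB x y z :
  dotr (y - x) (z - x) = (enorm (y - x) ^+ 2 + enorm (z - x) ^+ 2 - enorm (z - y) ^+ 2) / 2.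
Proof.
rewrite !enorm_sqr /dotr -sumrN -!big_split/= mulr_suml; apply: eq_bigr => i _.
by rewrite !mxE; field.
Qed.

Lemma norm_coord_le v i : `|v ord0 i| <= enorm v.
Proof.
rewrite -ler_sqr ?nnegrE ?enorm_ge0// real_normK ?num_real// enorm_sqr.
by rewrite (bigD1 i)//= lerDl sumr_ge0// => j _; exact: sqr_ge0.
Qed.

Lemma measurable_coord (i : 'I_d) :
  measurable_fun setT (fun v : borel_rV R d => (v : 'rV[R]_d) ord0 i).
Proof.
apply: (measurability (RGenOpens.G (R := R))); first exact: RGenOpens.measurableE.
move=> _ [_ [a [b ->]] <-]; rewrite setTI.
apply: sub_sigma_algebra.
have := @coord_continuous R 1 d ord0 i => /continuousP; apply.
exact: interval_open.
Qed.

Lemma measurable_coordB (i : 'I_d) : measurable_fun setT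
  (fun p : borel_rV R d * borel_rV R d => ((p.2 : 'rV[R]_d) - (p.1 : 'rV[R]_d)) ord0 i).
Proof.
have -> : (fun p : borel_rV R d * borel_rV R d => ((p.2 : 'rV[R]_d) - (p.1 : 'rV[R]_d)) ord0 i) =
   (fun p => (p.2 : 'rV[R]_d) ord0 i - (p.1 : 'rV[R]_d) ord0 i).
  by apply/funext => p; rewrite !mxE.
by apply: measurable_funB; apply: (measurableT_comp (measurable_coord i)).
Qed.

Definition eucl_dist (x y : borel_rV R d) : R := enorm ((y : 'rV[R]_d) - (x : 'rV[R]_d)).

Lemma measurable_eucl_dist :
  measurable_fun setT (fun p : borel_rV R d * borel_rV R d => eucl_dist p.1 p.2).
Proof.
have ms : measurable_fun setT (Num.sqrt : R -> R).
  by apply: continuous_measurable_fun; exact: sqrt_continuous.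
have h : measurable_fun setT (fun p : borel_rV R d * borel_rV R d => \sum_(i < d)
    ((p.2 : 'rV[R]_d) - (p.1 : 'rV[R]_d)) ord0 i ^+ 2).
  apply/measurable_EFinP.
  have -> : EFin \o (fun p : borel_rV R d * borel_rV R d => \sum_(i < d)
     ((p.2 : 'rV[R]_d) - (p.1 : 'rV[R]_d)) ord0 i ^+ 2) =
     (fun p => \sum_(i < d) ((((p.2 : 'rV[R]_d) - (p.1 : 'rV[R]_d)) ord0 i ^+ 2)%:E))%E.
    by apply/funext => p; rewrite /= sumEFin.
  apply: emeasurable_sum => i; apply/measurable_EFinP/measurable_funX.
  exact: measurable_coordB.
exact: (measurableT_comp ms h).
Qed.

End enorm.

(** * The energy of the operator as a triple integral *)

Section operator_energy.
Context {R : realType} {d : nat} (phi : R -> R).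
Hypothesis Hphi : class_Phi phi.
Variable eps : R.
Hypothesis eps0 : 0 < eps.
Variable nu : {finite_measure set (borel_rV R d) -> \bar R}.

Definition coord_kernel (i : 'I_d) (x y : borel_rV R d) : R :=
  ((y : 'rV[R]_d) - (x : 'rV[R]_d)) ord0 i *
  (if eps < eucl_dist x y then (eucl_dist x y * phi (eucl_dist x y))^-1 else 0).

Lemma measurable_coord_kernel i :
  measurable_fun setT (fun p : borel_rV R d * borel_rV R d => coord_kernel i p.1 p.2).
Proof.
apply: measurable_funM; first exact: measurable_coordB.
exact: (measurableT_comp (measurable_trunc_inv_mul Hphi eps0) measurable_eucl_dist).
Qed.

(** Boundedness gives integrability against a finite measure, so the real-valued integrals in
    [phi_operator] are genuine and not default values. *)
Lemma coord_kernel_bound i x y : `|coord_kernel i x y| <= (phi eps)^-1.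
Proof.
rewrite /coord_kernel normrM; case: ifPn => [ed|_]; last first.
  by rewrite normr0 mulr0 invr_ge0 ltW// (phi_gt0 Hphi).
have d0 := lt_trans eps0 ed; have p0 := phi_gt0 Hphi d0.
rewrite [X in _ * X]ger0_norm; last by rewrite invr_ge0 mulr_ge0// ltW.
apply: (@le_trans _ _ (eucl_dist x y * (eucl_dist x y * phi (eucl_dist x y))^-1)).
  by rewrite ler_wpM2r ?invr_ge0 ?mulr_ge0 ?(ltW d0) ?(ltW p0)// norm_coord_le.
rewrite invfM mulrA divff ?gt_eqF// mul1r.
by apply: (inv_phi_le Hphi) => //; exact: ltW.
Qed.

Lemma tri_angle_coord x y z : tri_angle phi (eucl_dist (d := d)) eps x y z =
  \sum_(i < d) coord_kernel i x y * coord_kernel i x z.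
Proof.
rewrite /tri_angle angle_kernelE -dotrBB /dotr mulr_suml; apply: eq_bigr => i _.
by rewrite /coord_kernel; ring.
Qed.

Lemma integrable_coord_kernel i x : nu.-integrable setT (EFin \o coord_kernel i x).
Proof.
apply: measurable_bounded_integrable => //.
- by rewrite ltey_eq fin_num_measure.
- exact: measurableT_comp (measurable_coord_kernel i) (pair1_measurable x).
- exists ((phi eps)^-1); split; first exact: num_real.
  by move=> M hM y _; apply: le_trans (coord_kernel_bound i x y) (ltW hM).
Qed.

Lemma phi_operator_coord x i :
  phi_operator phi nu eps (cst 1) x ord0 i = \int[nu]_y coord_kernel i x y.
Proof.
rewrite mxE /Rintegral [in LHS]integral_mkcond; congr fine.
apply: eq_integral => y _; rewrite patchE /coord_kernel /eucl_dist.
case: ifPn => [/set_mem/= h|/negP h].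
  by rewrite h mulr1 invfM mulrA.
by rewrite ifF ?mulr0//; apply/negP => h'; apply: h; rewrite inE.
Qed.

Let mass := fine (nu setT).

(** Used twice on the shifted angle kernel: integrated in [z], and then in [y], it is each time an
    affine combination of coordinate kernels. *)
Lemma integral_affine_coord (c : 'I_d -> R) (k : R) x :
  (\int[nu]_z (\sum_(i < d) c i * coord_kernel i x z + k)%:E =
  (\sum_(i < d) c i * phi_operator phi nu eps (cst 1) x ord0 i + k * mass)%:E)%E.
Proof.
have ic i : nu.-integrable setT (fun z => (c i)%:E * (EFin \o coord_kernel i x) z)%E.
  exact: integrableZl (integrable_coord_kernel i x).
transitivity (\int[nu]_z (\sum_(i < d) (c i)%:E * (EFin \o coord_kernel i x) z + cst k%:E z))%E.
  by apply: eq_integral => z _; rewrite EFinD -sumEFin.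
rewrite integralD//; last 2 first.
- exact: integrable_sum.
- by apply: finite_measure_integrable_cst.
rewrite integral_sum// integral_cst// EFinD -sumEFin; congr (_ + _)%E.
  apply: eq_bigr => i _; rewrite integralZl//; last exact: integrable_coord_kernel.
  rewrite phi_operator_coord EFinM; congr (_ * _)%E.
  by rewrite /Rintegral fineK//; apply: integrable_fin_num => //; exact: integrable_coord_kernel.
by rewrite EFinM fineK// fin_num_measure.
Qed.

Let energy (x : borel_rV R d) : \bar R :=
  ((enorm (phi_operator phi nu eps (cst 1) x) ^+ 2)%:E)%E.

Lemma energy_tri_shifted x :
  (energy x + \int[nu]_y \int[nu]_z (kernel_bound phi eps)%:E =
   \int[nu]_y \int[nu]_z tri_shifted phi (eucl_dist (d := d)) eps x y z)%E.
Proof.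
set M := kernel_bound phi eps.
have -> : (\int[nu]_y \int[nu]_z tri_shifted phi (eucl_dist (d := d)) eps x y z =
    \int[nu]_y (\sum_(i < d) phi_operator phi nu eps (cst 1) x ord0 i * coord_kernel i x y
      + M * mass)%:E)%E.
  apply: eq_integral => y _.
  transitivity (\int[nu]_z (\sum_(i < d) coord_kernel i x y * coord_kernel i x z + M)%:E)%E.
    by apply: eq_integral => z _; rewrite /tri_shifted tri_angle_coord.
  rewrite integral_affine_coord; congr (_%:E); congr (_ + _).
  by apply: eq_bigr => i _; rewrite mulrC.
rewrite integral_affine_coord /energy enorm_sqr EFinD; congr (_ + _)%E.
under eq_integral do rewrite integral_cst//.
by rewrite integral_cst// !EFinM fineK// fin_num_measure.
Qed.

Let D0 (x y : borel_rV R d) : 0 <= eucl_dist x y := enorm_ge0 _.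
Let DC (x y : borel_rV R d) : eucl_dist x y = eucl_dist y x := enormBC _ _.
Let Dtri (x y z : borel_rV R d) : eucl_dist x z <= eucl_dist x y + eucl_dist y z :=
  enorm_triangle _ _ _.

(** Indirectly: Tonelli's theorem makes the double integral of the shifted kernel measurable, and
    the energy differs from it by a finite constant. *)
Lemma measurable_energy : measurable_fun setT energy.
Proof.
have mS : mfun3 (tri_shifted phi (eucl_dist (d := d)) eps).
  exact: (mfun3_tri_shifted Hphi measurable_eucl_dist eps0).
have S0 := tri_shifted_ge0 Hphi D0 DC Dtri eps0.
have m := measurable_int2 nu mS S0.
pose k := (\int[nu]_y \int[nu]_z (kernel_bound phi eps)%:E)%E.
have kfin : k \is a fin_num.
  rewrite /k; under eq_integral do rewrite integral_cst//.
  by rewrite integral_cst// !fin_numM ?fin_num_measure.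
have -> : energy = (fun x => \int[nu]_y \int[nu]_z tri_shifted phi (eucl_dist (d := d)) eps x y z - k)%E.
  by apply/funext => x; rewrite -energy_tri_shifted addeK.
by apply: emeasurable_funB.
Qed.

Lemma integral_energy :
  (\int[nu]_x energy x + tri nu (fun _ _ _ => (kernel_bound phi eps)%:E) =
   tri nu (tri_shifted phi (eucl_dist (d := d)) eps))%E.
Proof.
have M0 : (0 <= kernel_bound phi eps) by exact: kernel_bound_ge0.
rewrite /tri -ge0_integralD//.
- by apply: eq_integral => x _; exact: energy_tri_shifted.
- by move=> x _; rewrite lee_fin sqr_ge0.
- exact: measurable_energy.
- by move=> x _; do 2 (apply: integral_ge0 => ? _); rewrite lee_fin.
Qed.

End operator_energy.

(** * Restriction of the measure to [Q] *)

Section restriction.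
Context {d : measure_display} {T : measurableType d} {R : realType}.
Variables (mu : {finite_measure set T -> \bar R}) (Q : set T) (mQ : measurable Q).
Local Open Scope ereal_scope.

Lemma integral_mrestr (A : set T) (f : T -> \bar R) :
  measurable A -> measurable_fun A f ->
  \int[mrestr mu mQ]_(x in A) f x = \int[mu]_(x in A `&` Q) f x.
Proof.
move=> mA mf.
have null : mrestr mu mQ (~` Q) = 0 by rewrite /mrestr setICl measure0.
have pos (g : T -> \bar R) : measurable_fun A g -> (forall x, 0 <= g x) ->
    \int[mrestr mu mQ]_(x in A) g x = \int[mu]_(x in A `&` Q) g x.
  move=> mg g0.
  rewrite (ge0_negligible_integral (measurableC mQ))// setDE setCK.
  apply: eq_measure_integral => B mB BA.
  rewrite /mrestr; congr (mu _); apply/setIidl => x /BA[].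
  by [].
rewrite integralE [RHS]integralE !pos//; first exact: measurable_funeneg.
exact: measurable_funepos.
Qed.

End restriction.

Section restricted_operator.
Context {R : realType} {d : nat} (phi : R -> R).
Hypothesis Hphi : class_Phi phi.
Variable eps : R.
Hypothesis eps0 : 0 < eps.
Variables (mu : {finite_measure set (borel_rV R d) -> \bar R}).
Variables (Q : set (borel_rV R d)) (mQ : measurable Q).

(** Reduces part (i) to the constant function 1 and the measure restricted to [Q]. *)
Lemma phi_operator_restr (x : 'rV[R]_d) :
  phi_operator phi mu eps \1_Q x = phi_operator phi (mrestr mu mQ) eps (cst 1) x.
Proof.
apply/rowP => i; rewrite !mxE /Rintegral; congr fine.
set A := (X in integral _ X).
have mDx : measurable_fun setT (eucl_dist (x : borel_rV R d)).
  exact: measurableT_comp measurable_eucl_dist (pair1_measurable (x : borel_rV R d)).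
have mA : measurable (A : set (borel_rV R d)).
  have h : measurable_fun setT (fun y : borel_rV R d => eps < eucl_dist (x : borel_rV R d) y).
    by exact: measurable_fun_ltr.
  by have := h measurableT [set true] I; rewrite setTI.
rewrite (integral_mrestr mu mQ mA); last first.
  apply/measurable_EFinP.
  apply: (@eq_measurable_fun _ _ _ _ _ (coord_kernel phi eps i (x : borel_rV R d))).
    move=> y /set_mem Ay; rewrite /coord_kernel /eucl_dist Ay.
    by rewrite mulr1 invfM mulrA.
  apply: (measurable_funS measurableT) => //.
  exact: measurableT_comp (measurable_coord_kernel Hphi eps0 i) (pair1_measurable (x : borel_rV R d)).
rewrite integral_mkcondr; apply: eq_integral => y _.
by rewrite patchE indicE; case: (y \in Q); rewrite ?mulr1// mulr0.
Qed.

End restricted_operator.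

(** * Lower limits at 0 and powers of 2 *)

Section limf.
Context {R : realType}.

Lemma le_limf_einf_right (f : R -> \bar R) (l : \bar R) (r : R) : 0 < r ->
  (forall e, 0 < e < r -> (l <= f e)%E) -> (l <= limf_einf f 0^'+)%E.
Proof.
move=> r0 h; rewrite limf_einfE; apply: le_ereal_sup_tmp.
exists (ereal_inf [set f x | x in [set e | 0 < e < r]]).
  exists [set e | 0 < e < r] => //.
  near=> e; apply/andP; split; near: e; [exact: nbhs_right_gt|exact: nbhs_right_lt].
by apply: le_ereal_inf_tmp => _ [e he <-]; exact: h.
Unshelve. all: by end_near. Qed.

End limf.

Section powR2.
Context {R : realType}.
Implicit Type s : R.

Lemma powR2_gt1 s : 0 < s -> 1 < 2 `^ s :> R.
Proof.
move=> s0; apply: (@le_lt_trans _ _ (1 `^ s)); first by rewrite powR1.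
by apply: gt0_ltr_powR => //; rewrite ?nnegrE// ltr1n.
Qed.

(** Here [s < 1] enters: the lower constant is proportional to [2 - L]. *)
Lemma powR2_lt2 s : s < 1 -> 2 `^ s < 2 :> R.
Proof.
move=> s1; have h : 1 < 2 `^ (1 - s) :> R by apply: powR2_gt1; rewrite subr_gt0.
have e : 2 `^ s * 2 `^ (1 - s) = 2 :> R.
  by rewrite -powRD ?subrKC ?powRr1//; apply/implyP.
have := @powR_gt0 R 2 s (ltr0n R 2); nra.
Qed.

End powR2.

(** * The two energy estimates *)

Section energy_bounds.
Context {R : realType} {d : nat} (phi : R -> R).
Hypothesis Hphi : class_Phi phi.
Variable L : R.
Hypothesis L1 : 1 < L.
Hypothesis dbl : forall t, 0 <= t -> phi (2 * t) <= L * phi t.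
Local Open Scope ereal_scope.

Let D : borel_rV R d -> borel_rV R d -> R := eucl_dist (d := d).
Let mD : measurable_fun setT (fun p : borel_rV R d * borel_rV R d => D p.1 p.2) :=
  measurable_eucl_dist.
Let D0 (x y : borel_rV R d) : (0 <= D x y)%R := enorm_ge0 _.
Let DC (x y : borel_rV R d) : D x y = D y x := enormBC _ _.
Let Dtri (x y z : borel_rV R d) : (D x z <= D x y + D y z)%R := enorm_triangle _ _ _.

Lemma phi_wolffE (nu : {finite_measure set (borel_rV R d) -> \bar R}) (x : 'rV[R]_d) :
  phi_wolff phi nu x = \int[nu]_y \int[nu]_z tri_wolff phi D (x : borel_rV R d) y z.
Proof. by rewrite -(wolff_potentialE Hphi nu mD). Qed.

Lemma measurable_phi_wolff (nu : {finite_measure set (borel_rV R d) -> \bar R}) :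
  measurable_fun setT (fun x : borel_rV R d => phi_wolff phi nu x).
Proof.
have mW : mfun3 (tri_wolff phi D) by exact: mfun3_tri_wolff.
have m := measurable_int2 nu mW (@tri_wolff_ge0 _ _ Hphi _ _ D).
by apply: eq_measurable_fun m => x _; rewrite phi_wolffE.
Qed.

Lemma integral_phi_wolff (nu : {finite_measure set (borel_rV R d) -> \bar R}) :
  \int[nu]_x phi_wolff phi nu x = tri nu (tri_wolff phi D).
Proof. by apply: eq_integral => x _; exact: phi_wolffE. Qed.

Lemma energy_upper (nu : {finite_measure set (borel_rV R d) -> \bar R}) eps : (0 < eps)%R ->
  \int[nu]_x (enorm (phi_operator phi nu eps (cst 1%R) x) ^+ 2)%:E <=
  (16 * upper_const L)%:E * \int[nu]_x phi_wolff phi nu x.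
Proof.
move=> eps0; rewrite integral_phi_wolff.
have := integral_energy Hphi eps0 nu.
exact: (tri_shifted_upper Hphi L1 dbl mD D0 DC Dtri eps0).
Qed.

(** The constant is [(2 - L) / 2] from the kernel, divided by 3 for the rotations and by the
    [L^2 / 2] of [tri_wolff_le_lower]. *)
Lemma energy_lower (nu : {finite_measure set (borel_rV R d) -> \bar R}) :
  (L < 2)%R -> concave_phi phi ->
  (forall x : 'rV[R]_d, nu (eball x t) @[t --> 0^'+] --> 0) ->
  ((2 - L) / 3 / L ^+ 2)%:E * \int[nu]_x phi_wolff phi nu x <=
  limf_einf (fun eps : R =>
    \int[nu]_x (enorm (phi_operator phi nu eps (cst 1%R) x) ^+ 2)%:E) 0^'+.
Proof.
move=> L2 cphi na; rewrite integral_phi_wolff.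
set E := limf_einf _ _.
have L0 := lt_trans ltr01 L1.
have no_atom (x : borel_rV R d) : nu [set y | (D x y <= 0)%R] = 0.
  apply/eqP; rewrite eq_le measure_ge0 andbT.
  apply: (cvge_to_ge (na x)); near=> t.
  apply: le_measure; rewrite ?inE.
  - have mDx : measurable_fun setT (D x) by exact: measurableT_comp mD (pair1_measurable x).
    have h : measurable_fun setT (fun y => (D x y <= 0)%R) by exact: measurable_fun_ler.
    by have := h measurableT [set true] I; rewrite setTI.
  - have mDx : measurable_fun setT (D x) by exact: measurableT_comp mD (pair1_measurable x).
    have h : measurable_fun setT (fun y => (D x y < t)%R) by exact: measurable_fun_ltr.
    by have := h measurableT [set true] I; rewrite setTI.
  - by move=> y /= h; apply: le_lt_trans h _; near: t; exact: nbhs_right_gt.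
(* The truncation of the lower kernel is frozen at [n.+1%:R^-1] while that of the operator tends to
   0, so the lower limit inherits a bound independent of [e]; only then does [n] go to infinity. *)
have lowE n : ((2 - L) / 2 / 3)%:E *
    tri nu (fun x y z => (tri_lower phi D n.+1%:R^-1 x y z)%:E) <= E.
  apply: (@le_limf_einf_right _ _ _ n.+1%:R^-1); first by rewrite invr_gt0.
  move=> e /andP[e0 en].
  apply: (tri_shifted_lower Hphi mD D0 DC Dtri e0 (integral_energy Hphi e0 nu)).
  - by rewrite divr_ge0// subr_ge0 ltW.
  - by apply: (mfun3_tri_lower Hphi mD); rewrite invr_ge0.
  - by move=> x y z; exact: tri_lower_ge0.
  move=> x y z.
  have t1 : (D x z <= D y z + D x y)%R by have := Dtri x y z; lra.
  have t2 : (D x y <= D y z + D x z)%R by have := Dtri x z y; rewrite (DC z y); lra.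
  have t3 : (D y z <= D x y + D x z)%R by have := Dtri y x z; rewrite (DC y x); lra.
  apply: le_trans (sym_kernel_ge Hphi cphi e0 L1 L2 dbl (D0 y z) (D0 x y) (D0 x z) t1 t2 t3).
  apply: ler_wpM2l; first by rewrite divr_ge0// subr_ge0 ltW.
  by apply: lower_kernel_nincr; exact: ltW.
have c0 : (0 < (2 - L) / 2 / 3)%R by rewrite !divr_gt0// subr_gt0.
have low0E : ((2 - L) / 2 / 3)%:E * tri nu (fun x y z => (tri_lower phi D 0 x y z)%:E) <= E.
  have c := @cvg_tri_lower _ _ Hphi _ _ nu D mD.
  apply: (cvge_to_le (cvgeZl _ c)) => //.
  by near=> n; exact: lowE.
apply: le_trans low0E.
have h := @tri_wolff_le_lower _ _ Hphi _ L1 dbl _ _ nu D mD DC Dtri no_atom.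
have k0 : (0 <= (2 - L) / 3 / L ^+ 2)%R.
  by rewrite !divr_ge0 ?sqr_ge0// subr_ge0 ltW.
apply: (le_trans (lee_wpmul2l _ h)); first by rewrite lee_fin.
rewrite muleA -EFinM.
have -> : ((2 - L) / 3 / L ^+ 2 * (L ^+ 2 / 2) = (2 - L) / 2 / 3)%R by field; rewrite gt_eqF.
by [].
Unshelve. all: by end_near. Qed.

End energy_bounds.

Theorem theorem2p3 (R : realType) :
  (forall s : R, 0 < s ->
     exists C : R, 0 < C /\
       forall (d : nat), (1 <= d)%N ->
       forall (phi : R -> R), class_Phi phi -> doubling_exponent phi s ->
       forall (mu : {finite_measure set (borel_rV R d) -> \bar R})
              (Q : set (borel_rV R d)) (mQ : measurable Q) (eps : R),
         0 < eps ->
         (\int[mu]_(x in Q) (enorm (phi_operator phi mu eps \1_Q x) ^+ 2)%:E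
          <= C%:E * \int[mu]_(x in Q) phi_wolff phi (mrestr mu mQ) x)%E)
  /\
  (forall s : R, 0 < s < 1 ->
     exists c : R, 0 < c /\
       forall (d : nat), (1 <= d)%N ->
       forall (phi : R -> R), class_Phi phi -> doubling_exponent phi s ->
         concave_phi phi ->
       forall (mu : {finite_measure set (borel_rV R d) -> \bar R}),
         (forall x : 'rV[R]_d, mu (eball x t) @[t --> 0^'+] --> 0%E) ->
         (c%:E * \int[mu]_x phi_wolff phi mu x
          <= limf_einf
               (fun eps : R =>
                  \int[mu]_x (enorm (phi_operator phi mu eps (cst 1) x) ^+ 2)%:E)
               0^'+)%E).
Proof.
split=> s hs.
  have L1 := powR2_gt1 hs.
  exists (16 * upper_const (2 `^ s)); split; first by rewrite mulr_gt0// upper_const_gt0.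
  move=> d _ phi Hphi [_ dbl] mu Q mQ eps eps0.
  pose nu : {finite_measure set (borel_rV R d) -> \bar R} := mrestr mu mQ.
  have mE := measurable_energy Hphi eps0 nu.
  have mW := measurable_phi_wolff Hphi nu.
  have := energy_upper Hphi L1 dbl nu eps0.
  rewrite (integral_mrestr mu mQ measurableT mE) (integral_mrestr mu mQ measurableT mW) !setTI.
  apply: le_trans; rewrite le_eqVlt; apply/orP; left; apply/eqP.
  by apply: eq_integral => x _; rewrite (phi_operator_restr Hphi eps0 mu mQ).
have /andP[s0 s1] := hs; have [L1 L2] := (powR2_gt1 s0, powR2_lt2 s1).
exists ((2 - 2 `^ s) / 3 / (2 `^ s) ^+ 2); split.
  by rewrite !divr_gt0 ?subr_gt0// exprn_gt0// powR_gt0.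
move=> d _ phi Hphi [_ dbl] cphi mu na.
exact: energy_lower.
Qed.
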